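(* Let $M$ be a smooth $n$-dimensional manifold, let $X^1,\dots,X^m,A$ be smooth vector fields on $M$, and let $\mathcal A=\frac12\sum_{j=1}^m\mathcal L_{X^j}\mathcal L_{X^j}+\mathcal L_A$. Assume $E_x=\mathrm{span}\{X^1(x),\dots,X^m(x)\}$ has dimension independent of $x\in M$, so that $E=\bigcup_xE_x$ is a sub-bundle of $TM$. Let $\mathcal B$ be the generator on the linear frame bundle $\pi:GL(M)\to M$ of the derivative process $u_t=T\xi_t\circ u_0$ of the stochastic differential equation $dx_t=X(x_t)\circ dB_t+A(x_t)dt$. Then the semi-connection $\nabla$ induced by $\mathcal B$ is the adjoint connection of the LeJan-Watanabe connection $\breve\nabla$ determined by $X$. Consequently, for any vector field $V$ on $M$ and any $w\in E_x$, $x\in M$, $$\nabla_wV=(\mathcal L_{Z^w}V)(x),$$ and also $\breve\nabla_{V(x)}Z^w=0$ whenever $w\in E_x$.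
   Context: Map $X$ and LeJan-Watanabe connection. $X(x):\mathbb R^m\to E_x$ is $X(x)(e)=\sum_j e^jX^j(x)$. It induces a Riemannian metric $\langle\cdot,\cdot\rangle_x$ on $E$ (the one making $X(x)$ restricted to $(\ker X(x))^\perp$ an isometry onto $E_x$). $Y_x=Y(x):E_x\to\mathbb R^m$ is the adjoint: $\langle Y_x(v),e\rangle_{\mathbb R^m}=\langle X(x)(e),v\rangle_x$. The LeJan-Watanabe connection $\breve\nabla$ is the metric connection on $E$ uniquely defined by requiring, for each $x$, $\breve\nabla_v(X(\cdot)(e))=0$ for all $v\in T_xM$ whenever $e$ is orthogonal to $\ker X(x)$; equivalently $\breve\nabla_vU=X(x)\,d\big(Y_\cdot(U(\cdot))\big)(v)$, $v\in T_xM$, for differentiable sections $U$ of $E$. For $w\in E_x$, $Z^w$ is the section of $E$ given by $Z^w(y)=X(y)Y(x)(w)$, $y\in M$. Adjoint. The adjoint of $\breve\nabla$ is the semi-connection over $E$ on $TM$ (differentiating vector fields in directions of $E$) given by $\breve\nabla'_{U(x)}V=\breve\nabla_{V(x)}U+[U,V](x)$, for $U$ a differentiable section of $E$ and $V$ a vector field on $M$. Derivative process. $B$ is a Brownian motion on $\mathbb R^m$, $\circ$ denotes Stratonovich differential. $GL(M)$ is the bundle of linear isomorphisms $u:\mathbb R^n\to T_{\pi(u)}M$, with right action of $GL(n)$. For a solution $x_t$, up to its explosion time, $T\xi_t:T_{x_0}M\to T_{x_t}M$ is the linear derivative process; with respect to any torsion free connection $v_t=T\xi_t(v_0)$ solves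 $Dv_t=\nabla X(v_t)\circ dB_t+\nabla A(v_t)dt$. Equivalently, $\mathcal B=\frac12\sum_j\mathcal L_{\tilde X^j}\mathcal L_{\tilde X^j}+\mathcal L_{\tilde A}$, where for a vector field $W$ on $M$ with local flow $\phi_t$, $\tilde W$ is the vector field on $GL(M)$ with local flow $u\mapsto T\phi_t\circ u$. $\mathcal B$ is equivariant and induces $\mathcal A$ on $M$. Semi-connection induced by $\mathcal B$. The symbol of an operator $\mathcal D$ is defined by $df(\sigma^{\mathcal D}(dg))=\frac12\mathcal D(fg)-\frac12\mathcal D(f)g-\frac12f\mathcal D(g)$. The horizontal lift is $h_u:E_{\pi(u)}\to T_uGL(M)$, $h_u(v)=\sigma^{\mathcal B}_u((T_u\pi)^*\alpha)$ for any $\alpha\in T^*_{\pi(u)}M$ with $\sigma^{\mathcal A}(\alpha)=v$ (this is well defined). The associated covariant derivative of a vector field $V$ on $M$ in the direction $w\in E_x$ is $\nabla_wV=u\big(d\tilde V(h_u(w))\big)$, $u\in\pi^{-1}(x)$, where $\tilde V:GL(M)\to\mathbb R^n$, $\tilde V(u)=u^{-1}V(\pi(u))$. *)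

(* Defs.v *)
From HB Require Import structures.
From mathcomp Require Import all_boot all_order all_algebra.
From mathcomp Require Import all_classical all_reals all_analysis.

Set Implicit Arguments.
Unset Strict Implicit.
Unset Printing Implicit Defensive.

Import Order.TTheory GRing.Theory Num.Theory.
Import numFieldNormedType.Exports.

Local Open Scope classical_set_scope.
Local Open Scope ring_scope.

(* [Ck k U f]: all iterated directional derivatives of f of order <= k exist
   and are continuous on U; only used with U open and E finite-dimensional,
   where this is the usual class C^k. *)
Fixpoint Ck (R : realType) (E F : normedModType R) (k : nat) (U : set E)
    (f : E -> F) : Prop :=
  (forall x, U x -> {for x, continuous f}) /\
  (if k is k'.+1 then
     forall v : E, (forall x, U x -> derivable f x v) /\ Ck k' U ('D_v f)
   else True).

Definition smooth_on (R : realType) (E F : normedModType R) (U : set E)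
    (f : E -> F) : Prop := forall k, Ck k U f.

(* Sets with an atlas modelled on E.  The chart i is the bijection
   [fwd i : dom i -> fwd i @` dom i] with inverse [bwd i]; the values of these
   functions elsewhere are irrelevant.  [at_ x] is a chart around x. *)
Record charted (R : realType) (E : normedModType R) := Charted {
  pt :> choiceType;
  idx : Type;
  dom : idx -> set pt;
  fwd : idx -> pt -> E;
  bwd : idx -> E -> pt;
  at_ : pt -> idx }.

Arguments dom {R E c}.
Arguments fwd {R E c}.
Arguments bwd {R E c}.
Arguments at_ {R E c}.

Section AtlasTopology.
Context (R : realType) (E : normedModType R).

Definition atlas_space (M : charted E) : Type := M.

Definition atlas_subbase (M : charted E) : set (set M) :=
  [set A | exists i (O : set E), open O /\ A = dom i `&` fwd i @^-1` O].

HB.instance Definition _ (M : charted E) := Choice.on (atlas_space M).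
HB.instance Definition _ (M : charted E) :=
  isSubBaseTopological.Build (atlas_space M) (@atlas_subbase M) id.

Record smooth_manifold (M : charted E) : Prop := SmoothManifold {
  dom_at : forall x : M, dom (at_ x) x;
  fwdK : forall (i : idx M) x, dom i x -> bwd i (fwd i x) = x;
  open_overlap : forall i j : idx M, open (fwd i @` (dom i `&` dom j));
  smooth_transition : forall i j : idx M,
    smooth_on (fwd i @` (dom i `&` dom j)) (fwd j \o bwd i);
  hausdorff_atlas : hausdorff_space (atlas_space M);
  second_countable_atlas : @second_countable (atlas_space M) }.

End AtlasTopology.

(* The tangent space T_xM is identified with the model space E through the
   preferred chart [at_ x]: v in T_xM is the element of E which represents it
   in that chart.  In particular T_xM = R^n when E = R^n. *)
Section Calculus.
Context (R : realType) (E : normedModType R) (M : charted E).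

Definition vfield := M -> E.

Definition smooth_at (F : normedModType R) (x : M) (f : M -> F) : Prop :=
  exists2 O, open_nbhs (fwd (at_ x) x) O & smooth_on O (f \o bwd (at_ x)).

Definition differentiable_at (F : normedModType R) (x : M) (f : M -> F) : Prop :=
  differentiable (f \o bwd (at_ x)) (fwd (at_ x) x).

Definition dfun (F : normedModType R) (f : M -> F) (x : M) (v : E) : F :=
  'D_v (f \o bwd (at_ x)) (fwd (at_ x) x).

Definition lieD (F : normedModType R) (W : vfield) (f : M -> F) : M -> F :=
  fun x => dfun f x (W x).

(* [lieD W (fwd c)] is the local expression of W in the chart c. *)
Definition smooth_vf (W : vfield) : Prop :=
  forall x, smooth_at x (lieD W (fwd (at_ x))).

Definition differentiable_vf (W : vfield) : Prop :=
  forall x, differentiable_at x (lieD W (fwd (at_ x))).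

(* The commutator UV - VU of derivations, applied to the preferred chart at x;
   this is also the Lie derivative of V along U. *)
Definition lie_bracket (U V : vfield) : vfield := fun x =>
  lieD U (lieD V (fwd (at_ x))) x - lieD V (lieD U (fwd (at_ x))) x.

(* phi is a local flow of W, with domain D an open neighbourhood of {0} x M. *)
Definition local_flow (W : vfield) (D : R -> set M) (phi : R -> M -> M) : Prop :=
  [/\ forall x, D 0 x /\ phi 0 x = x,
      forall x, is_interval [set t | D t x],
      forall t x, D t x ->
        exists O : set (R * E),
          [/\ open_nbhs (t, fwd (at_ x) x) O,
              forall p, O p -> D p.1 (bwd (at_ x) p.2) /\
                dom (at_ (phi t x)) (phi p.1 (bwd (at_ x) p.2)) &
              smooth_on O (fun p : R * E =>
                fwd (at_ (phi t x)) (phi p.1 (bwd (at_ x) p.2)))] &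
      forall t x, D t x ->
        is_derive t (1 : R) (fun s => fwd (at_ (phi t x)) (phi s x))
          (W (phi t x))].

Definition diffusion_generator (m : nat) (X : 'I_m -> vfield) (A : vfield)
    (f : M -> R) : M -> R := fun x =>
  2^-1 * (\sum_(j < m) lieD (X j) (lieD (X j) f) x) + lieD A f x.

(* The symbol sigma^D_x : T*_xM -> T_xM. *)
Definition symbol (D : (M -> R) -> (M -> R)) (x : M) (alpha : E -> R) : E :=
  xget 0 [set z | forall f g : M -> R, smooth_at x f -> smooth_at x g ->
    (forall v, dfun g x v = alpha v) ->
    dfun f x z = 2^-1 * D (fun y => f y * g y) x
                 - 2^-1 * (D f x * g x) - 2^-1 * (f x * D g x)].

End Calculus.

Definition tangent_map (R : realType) (E F : normedModType R) (M : charted E)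
    (N : charted F) (phi : M -> N) (x : M) : E -> F :=
  dfun (fwd (at_ (phi x)) \o phi) x.

(* For linear L and a matrix a viewed as a linear map, the matrix of L o a. *)
Definition comp_cols (R : realType) (n : nat) (L : 'cV[R]_n -> 'cV[R]_n)
    (a : 'M[R]_n) : 'M[R]_n := \matrix_(i, k) L (col k a) i ord0.

(* A frame u : R^n -> T_xM at x is the pair of x and the invertible matrix of u
   with respect to the identification T_xM = R^n. *)
Section FrameBundle.
Context (R : realType) (n : nat) (M : charted 'cV[R]_n).

Definition frame_type := (M * {a : 'M[R]_n | a \in unitmx})%type.

(* Only meant for invertible a. *)
Definition mk_frame (x : M) (a : 'M[R]_n) : frame_type :=
  (x, insubd (exist (fun a : 'M[R]_n => a \in unitmx) 1%:M (unitmx1 R n)) a).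

(* The chart (x, a) |-> (fwd i x, T_x(fwd i) o a) induced by the chart i. *)
Definition GL : charted ('cV[R]_n * 'M[R]_n)%type :=
  @Charted R ('cV[R]_n * 'M[R]_n)%type frame_type (idx M)
    (fun i u => dom i u.1)
    (fun i u => (fwd i u.1, comp_cols (dfun (fwd i) u.1) (val u.2)))
    (fun i p => mk_frame (bwd i p.1)
       (comp_cols (fun v => 'D_v (fwd (at_ (bwd i p.1)) \o bwd i) p.1) p.2))
    (fun u => at_ u.1).

Definition GLproj (u : GL) : M := u.1.
Definition frame_mx (u : GL) : 'M[R]_n := val u.2.

(* u |-> T phi o u *)
Definition frame_push (phi : M -> M) (u : GL) : GL :=
  mk_frame (phi (GLproj u))
    (comp_cols (tangent_map phi (GLproj u)) (frame_mx u)).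

(* Wt is the vector field on GL(M) whose local flow is u |-> T phi_t o u,
   phi_t being the local flow of W. *)
Definition natural_lift (W : vfield M) (Wt : vfield GL) : Prop :=
  exists D phi, local_flow W D phi /\
    local_flow Wt (fun t u => D t (GLproj u)) (fun t => frame_push (phi t)).

(* The generator of u_t = T xi_t o u_0, in Hoermander form:
   B = 1/2 sum_j L_{Xt^j} L_{Xt^j} + L_{At}. *)
Definition derivative_process_generator (m : nat) (X : 'I_m -> vfield M)
    (A : vfield M) (B : (GL -> R) -> (GL -> R)) : Prop :=
  exists (Xt : 'I_m -> vfield GL) (At : vfield GL),
    [/\ forall j, natural_lift (X j) (Xt j), natural_lift A At &
        B = diffusion_generator Xt At].

(* h_u(v) = sigma^B_u((T_u pi)^* alpha) for any alpha with
   sigma^A(alpha) = v. *)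
Definition hlift (A : (M -> R) -> (M -> R)) (B : (GL -> R) -> (GL -> R))
    (u : GL) (v : 'cV[R]_n) : 'cV[R]_n * 'M[R]_n :=
  xget 0 [set z | forall alpha : 'cV[R]_n -> R, scalar alpha ->
    symbol A (GLproj u) alpha = v ->
    z = symbol B u (fun s => alpha (tangent_map GLproj u s))].

Definition frame_coord (V : vfield M) (u : GL) : 'cV[R]_n :=
  invmx (frame_mx u) *m V (GLproj u).

(* [induced_connection A B x w V] is nabla_w V at x; the value does not depend
   on the frame u above x. *)
Definition induced_connection (A : (M -> R) -> (M -> R))
    (B : (GL -> R) -> (GL -> R)) (x : M) (w : 'cV[R]_n) (V : vfield M)
    : 'cV[R]_n :=
  xget 0 [set z | forall u : GL, GLproj u = x ->
    z = frame_mx u *m dfun (frame_coord V) u (hlift A B u w)].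

End FrameBundle.

Section LeJanWatanabe.
Context (R : realType) (n m : nat) (M : charted 'cV[R]_n).
Variable X : 'I_m -> vfield M.

Definition distr (x : M) : {vspace 'cV[R]_n} := <<[seq X j x | j : 'I_m]>>%VS.

Definition Xmap (x : M) (e : 'cV[R]_m) : 'cV[R]_n :=
  \sum_(j < m) e j ord0 *: X j x.

Definition dot (e f : 'cV[R]_m) : R := \sum_(j < m) e j ord0 * f j ord0.

Definition perp_ker (x : M) (e : 'cV[R]_m) : Prop :=
  forall k, Xmap x k = 0 -> dot e k = 0.

(* The inverse of the bijection X(x) : (ker X(x))^perp -> E_x. *)
Definition Xinv (x : M) (v : 'cV[R]_n) : 'cV[R]_m :=
  xget 0 [set e | perp_ker x e /\ Xmap x e = v].

Definition metric (x : M) (v w : 'cV[R]_n) : R := dot (Xinv x v) (Xinv x w).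

Definition Yadj (x : M) (v : 'cV[R]_n) : 'cV[R]_m :=
  xget 0 [set y | forall e, dot y e = metric x (Xmap x e) v].

Definition Zsec (x : M) (w : 'cV[R]_n) : vfield M := fun y => Xmap y (Yadj x w).

Definition dsection (U : vfield M) : Prop :=
  differentiable_vf U /\ forall x, U x \in distr x.

(* [nabla x v U] is the derivative of the section U in the direction
   v in T_xM. *)
Definition connection_type := M -> 'cV[R]_n -> vfield M -> 'cV[R]_n.

Record connection_on_E (nabla : connection_type) : Prop := ConnectionOnE {
  conn_distr : forall x v U, dsection U -> nabla x v U \in distr x;
  conn_linear : forall x (a : R) v w U, dsection U ->
    nabla x (a *: v + w) U = a *: nabla x v U + nabla x w U;
  conn_add : forall x v U U', dsection U -> dsection U' ->
    nabla x v (fun y => U y + U' y) = nabla x v U + nabla x v U';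
  conn_leibniz : forall x v (f : M -> R) U,
    (forall y, differentiable_at y f) -> dsection U ->
    nabla x v (fun y => f y *: U y) = dfun f x v *: U x + f x *: nabla x v U;
  conn_smooth : forall U V, dsection U -> smooth_vf U -> smooth_vf V ->
    smooth_vf (fun x => nabla x (V x) U) }.

Definition metric_connection (nabla : connection_type) : Prop :=
  forall x v U U', dsection U -> dsection U' ->
    dfun (fun y => metric y (U y) (U' y)) x v =
    metric x (nabla x v U) (U' x) + metric x (U x) (nabla x v U').

Definition LeJanWatanabe (nabla : connection_type) : Prop :=
  [/\ connection_on_E nabla, metric_connection nabla &
      forall x v e, perp_ker x e -> nabla x v (fun y => Xmap y e) = 0].

(* nabla' is the semi-connection over E on TM adjoint to nabla. *)
Definition adjoint_connection (nabla nabla' : connection_type) : Prop :=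
  forall x U V, dsection U -> differentiable_vf V ->
    nabla' x (U x) V = nabla x (V x) U + lie_bracket U V x.

End LeJanWatanabe.

(* Main.v *)
(* The symbol of a generator 1/2 sum_j L_{X^j} L_{X^j} + L_A sends alpha to
   1/2 sum_j alpha(X^j) X^j.  If this vector is w, the coefficients
   e_j = 1/2 alpha(X^j) form a vector of (ker X(x))^perp with X(x) e = w, so
   e = Y(x) w, and the horizontal lift of w is sum_j e_j X~^j, the value at u of
   the natural lift of Z^w.  In a chart this natural lift is
   (Z^w, DZ^w o u), by exchanging the time derivative and the space derivative
   of the flow.  Differentiating u^-1 V along it gives
   D_w V - D_V Z^w = [Z^w, V](x).
   On the other side, a section U is sum_j f_j X^j with f = Y U, and f is
   differentiable because X has constant rank.  The Leibniz rule together with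
   the vanishing of the LeJan-Watanabe derivative of X(.)(f(x)) at x leaves
   sum_j df_j(v) X^j(x), which is D_v U - D_v Z^{U(x)}; for v = V(x) this is the
   difference between the brackets [Z^{U(x)}, V](x) and [U, V](x). *)
Require Import Defs.
From HB Require Import structures.
From mathcomp Require Import all_boot all_order all_algebra.
From mathcomp Require Import all_classical all_reals all_analysis.
From mathcomp Require Import ring lra.

Set Implicit Arguments.
Unset Strict Implicit.
Unset Printing Implicit Defensive.

Import Order.TTheory GRing.Theory Num.Theory.
Import numFieldNormedType.Exports.

Local Open Scope classical_set_scope.
Local Open Scope ring_scope.

(** * Differential calculus in finite dimension *)

(** Two features of the encoding shape the proof. Since [smooth_on] speaks of iterated directional
    derivatives, Fréchet differentiability and the symmetry of second derivatives have to be earned;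
    both rest on the mean value theorem along lines and on coordinates of the model space. And a
    tangent vector at [y] is read in the preferred chart [at_ y], which may jump with [y]: a field
    [W : M -> E] need not be continuous as a map, so every computation at [x] uses its local
    expression [lieD W (fwd (at_ x))] in the single chart [at_ x], whose value at [x] is [W x]. The
    objects defined by [xget] are identified by existence and uniqueness. For the horizontal lift,
    uniqueness asks for an actual covector with symbol [w], for the induced connection an actual
    frame; a Gram matrix supplies the covector. A connection acts here on global sections. No
    cut-off functions appear, because the pseudo-inverse of X yields coefficients on all of M. *)

Section DifferentialCalculus.
Context {R : realType}.
Implicit Types E F G : normedModType R.

Lemma near_eq_differentiable E F (f g : E -> F) (x : E) :
  (\near x, f x = g x) -> differentiable f x ->
  differentiable g x /\ 'd g x = 'd f x :> (E -> F).
Proof.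
move=> fg df; have fgx : f x = g x := nbhs_singleton fg.
have fg0 : \forall h \near (0 : E), f (h + x) = g (h + x).
  by have := fg; rewrite (near_shift 0 x) subr0.
have gE : g \o shift x = cst (g x) + 'd f x +o_ 0 id.
  apply/eqaddoP => _/posnumP[e].
  have := diff_locally df; move=> /eqaddoP /(_ e%:num) /(_ [gt0 of e%:num]).
  apply: filterS2 fg0 => h fgh.
  by rewrite !fctE/= fgh fgx.
have dgf : 'd g x = 'd f x :> (E -> F) by apply: diff_unique gE; exact: diff_continuous.
split=> //; apply/diff_locallyP; rewrite dgf; split=> //.
exact: diff_continuous.
Qed.

Lemma near_differentiable E F (f g : E -> F) (x : E) :
  (\near x, f x = g x) -> differentiable f x -> differentiable g x.
Proof. by move=> fg df; have [] := near_eq_differentiable fg df. Qed.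

Lemma diff_derive E F (f : E -> F) (x : E) (v : E) (l : F) :
  differentiable f x -> 'd f x v = l -> is_derive x v f l.
Proof. by move=> df <-; rewrite -deriveE//; exact/derivableP/diff_derivable. Qed.

Lemma derive_comp E F G (f : E -> F) (g : F -> G) (x v : E) :
  differentiable f x -> differentiable g (f x) ->
  'D_v (g \o f) x = 'd g (f x) ('d f x v).
Proof.
move=> df dg; rewrite deriveE; last exact: differentiable_comp.
by rewrite diff_comp.
Qed.

Lemma is_derive_comp E F (c : R -> E) (f : E -> F) (t : R) (v : E) :
  is_derive t 1 c v -> differentiable f (c t) ->
  is_derive t 1 (f \o c) ('d f (c t) v).
Proof.
move=> [/derivable1_diffP dc cv] df; apply: diff_derive.
  exact: differentiable_comp.
by rewrite diff_comp//= -cv [in RHS]deriveE.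
Qed.

Lemma linear_derive E F (l : {linear E -> F}) (x v : E) : continuous l ->
  'D_v l x = l v.
Proof. by move=> lc; rewrite deriveE ?diff_lin//; exact: linear_differentiable. Qed.

(** Only derivability along [v] is assumed, so the linear map is moved through the difference
    quotient and its continuity gives the limit. *)
Lemma linear_is_derive E F G (l : {linear F -> G}) (f : E -> F) (x v : E) :
  continuous l -> derivable f x v -> is_derive x v (l \o f) (l ('D_v f x)).
Proof.
move=> lc fxv; have key : (fun h => h^-1 *: (((l \o f) \o shift x) (h *: v) -
     (l \o f) x)) @ 0^' --> l ('D_v f x).
  rewrite (_ : (fun _ => _) =
    l \o (fun h => h^-1 *: ((f \o shift x) (h *: v) - f x))); last first.
    apply/funext => h /=; by rewrite [RHS]linearZ/= [in RHS]linearB.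
  by apply: continuous_cvg; [exact: lc|exact: fxv].
by split; [apply/cvg_ex; eexists; exact: key|exact: cvg_lim key].
Qed.

(* Finite dimension, with the continuity of the coordinate forms built in. *)
Definition has_coords E := exists (I : finType) (e : I -> E)
  (c : I -> {linear E -> R}),
  (forall k, continuous (c k)) /\ forall h, h = \sum_k c k h *: e k.

Lemma differentiable_fsum E F (I : finType) (f : I -> E -> F) (x : E) :
  (forall i, differentiable (f i) x) ->
  differentiable (fun y => \sum_i f i y) x.
Proof.
move=> df; rewrite (_ : (fun _ => _) = \sum_i f i); last first.
  by apply/funext => y; rewrite fct_sumE.
elim/big_ind: _ => [|g h|i _]; last exact: df.
  exact: differentiable_cst.
exact: differentiableD.
Qed.

Lemma differentiable_coords E F (I : finType) (e : I -> F)
    (c : I -> {linear F -> R}) (f : E -> F) (x : E) :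
  (forall h, h = \sum_k c k h *: e k) ->
  (forall k, differentiable (c k \o f) x) -> differentiable f x.
Proof.
move=> ce df; rewrite (_ : f = fun y => \sum_k (c k \o f) y *: e k).
  by apply: differentiable_fsum => k; exact: differentiableZl.
by apply/funext => y; rewrite [LHS]ce.
Qed.

Lemma is_derive_line E F (f : E -> F) (z e : E) (s : R) :
  derivable f (z + s *: e) e ->
  is_derive s 1 (fun t : R => f (z + t *: e)) ('D_e f (z + s *: e)).
Proof.
move=> fze.
suff key : (fun h : R => h^-1 *: (((fun t : R => f (z + t *: e)) \o shift s)
    (h *: (1 : R)) - f (z + s *: e))) @ 0^' --> 'D_e f (z + s *: e).
  by split; [apply/cvg_ex; eexists; exact: key|exact: cvg_lim key].
rewrite (_ : (fun _ => _) = (fun h : R => h^-1 *: ((f \o shift (z + s *: e))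
    (h *: e) - f (z + s *: e)))); first exact: fze.
apply/funext => h /=; congr (_ *: (f _ - _)).
by rewrite scalerDl [h *: 1]mulr1 addrCA.
Qed.

(** A coordinate increment [t] has either sign; the symmetric range [|s| <= |t|] spares the users of
    the lemma the distinction. *)
Lemma MVT_line E (f : E -> R) (z e : E) (t : R) :
  (forall s : R, `|s| <= `|t| -> derivable f (z + s *: e) e) ->
  exists2 s : R, `|s| <= `|t| & f (z + t *: e) - f z = t * 'D_e f (z + s *: e).
Proof.
move=> df.
have dfs (s : R) : `|s| <= `|t| ->
    is_derive s (1 : R) (fun t : R => f (z + t *: e)) ('D_e f (z + s *: e)).
  by move=> st; apply: is_derive_line; exact: df.
have cont (s : R) : `|s| <= `|t| -> {for s, continuous (fun t : R => f (z + t *: e))}.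
  by move=> /dfs [/derivable1_diffP/differentiable_continuous].
have [t0|t0] := leP 0 t.
  have [||s sI] := @MVT_segment R (fun t => f (z + t *: e))
    (fun s => 'D_e f (z + s *: e)) 0 t t0.
  - move=> s; rewrite in_itv/= => /andP[s0 st]; apply: dfs.
    by rewrite !ger0_norm// ltW.
  - apply: continuous_in_subspaceT => s; rewrite inE/= in_itv/= => /andP[s0 st].
    by apply: cont; rewrite !ger0_norm.
  - move: sI; rewrite in_itv/= => /andP[s0 st].
    rewrite scale0r addr0 subr0 => ->; exists s; last by rewrite mulrC.
    by rewrite !ger0_norm.
have [||s sI] := @MVT_segment R (fun t => f (z + t *: e))
  (fun s => 'D_e f (z + s *: e)) t 0 (ltW t0).
- move=> s; rewrite in_itv/= => /andP[s0 st]; apply: dfs.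
  by rewrite !ltr0_norm// lerN2 ltW.
- apply: continuous_in_subspaceT => s; rewrite inE/= in_itv/= => /andP[s0 st].
  by apply: cont; rewrite (ltr0_norm t0) ler0_norm// lerN2.
- move: sI; rewrite in_itv/= => /andP[s0 st].
  rewrite scale0r addr0 sub0r => eqf; exists s.
    by rewrite (ltr0_norm t0) ler0_norm// lerN2.
  by apply: oppr_inj; rewrite opprB eqf mulrN mulrC.
Qed.

End DifferentialCalculus.

(** * Continuous directional derivatives: differentiability and symmetry *)

Section ContinuouslyDifferentiable.
Context {R : realType}.
Implicit Types E F : normedModType R.

Lemma near_eq_continuous E F (f g : E -> F) (x : E) :
  (\near x, f x = g x) -> {for x, continuous f} -> {for x, continuous g}.
Proof.
move=> fg fc; rewrite /prop_for /continuous_at -(nbhs_singleton fg).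
by apply: cvg_trans fc; exact: near_eq_cvg.
Qed.

(** The point [x + h] is reached from [x] by changing one coordinate at a time. On each leg the mean
    value theorem compares the increment with the derivative at [x], and continuity of that
    derivative makes the error small against [|h|]. *)
Lemma C1_differentiable_scalar E (f : E -> R) (x : E) : has_coords E ->
  (forall v, \near x, derivable f x v) ->
  (forall v, {for x, continuous ('D_v f)}) -> differentiable f x.
Proof.
move=> [I [e [c [cc ce]]]] df Dfc.
pose L h : R := \sum_k c k h * 'D_(e k) f x.
have linL : linear L.
  move=> a u v; rewrite /L scaler_sumr -big_split/=; apply: eq_bigr => k _.
  by rewrite linearP mulrDl -scalerAl.
pose LL : {linear E -> R} := HB.pack L (GRing.isLinear.Build _ _ _ _ _ linL).
have Lc : continuous LL.
  move=> y; apply: differentiable_continuous; apply: differentiable_fsum => k.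
  apply: differentiableM; first exact: linear_differentiable.
  exact: differentiable_cst.
suff fL : f \o shift x = cst (f x) + LL +o_ 0 id.
  by apply/diff_locallyP; rewrite (diff_unique Lc fL).
have ac (s : seq I) : continuous (fun h : E => \sum_(k <- s) c k h *: e k).
  elim: s => [|k s IHs] h.
    under [X in continuous_at _ X]eq_fun do rewrite big_nil.
    exact: cvg_cst.
  under [X in continuous_at _ X]eq_fun do rewrite big_cons.
  by apply: cvgD; [apply: cvgZr_tmp; exact: cc|exact: IHs].
(* The induction runs over the list of coordinates already changed, for all [eps] at once, since
   each new leg takes half of it. *)
suff key (s : seq I) (eps : R) : 0 < eps -> \forall h \near (0 : E),
    `|f (x + \sum_(k <- s) c k h *: e k) - f x -
      \sum_(k <- s) c k h * 'D_(e k) f x| <= eps * `|h|.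
  apply/eqaddoP => eps eps0; apply: filterS (key (index_enum I) _ eps0) => h.
  rewrite -ce; have -> : (f \o shift x - (cst (f x) + LL)) h =
      f (x + h) - f x - \sum_k c k h * 'D_(e k) f x.
    by rewrite !fctE/= opprD addrA [h + x]addrC.
  by [].
elim: s eps => [|k s IHs] eps eps0.
  by near=> h; rewrite !big_nil addr0 !subrr normr0 mulr_ge0// ltW.
have [C C0 Cc] := linear_lipschitz (cc k).
have eps20 : 0 < eps / 2 by rewrite divr_gt0.
(* [C] bounds the coordinate form, so an error of [eps / 2 / C] in the derivative costs at most
   [eps / 2 * |h|]. *)
have epsC : 0 < eps / 2 / C by rewrite divr_gt0.
have : \forall y \near x, derivable f y (e k) /\
    `|'D_(e k) f x - 'D_(e k) f y| <= eps / 2 / C.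
  apply: filterI; first exact: df.
  by move: (Dfc (e k)) => /cvgrPdist_le; apply.
move=> /nbhs_normP[r /= r0 rP].
have r20 : 0 < r / 2 by rewrite divr_gt0.
have near_a : \forall h \near (0 : E), `|\sum_(j <- s) c j h *: e j| < r / 2.
  have := ac s 0; rewrite /continuous_at big1; last first.
    by move=> j _; rewrite linear0 scale0r.
  by move=> /cvgr0Pnorm_lt; apply.
near=> h.
have na : `|\sum_(j <- s) c j h *: e j| < r / 2 by near: h; exact: near_a.
rewrite !big_cons [x + _]addrCA addrA; set a := \sum_(j <- s) _ *: _ in na *.
have nk : `|c k h| * `|e k| < r / 2.
  near: h.
  have : (fun h => c k h *: e k) h @[h --> 0] --> c k 0 *: e k.
    by apply: cvgZr_tmp; exact: cc.
  rewrite linear0 scale0r => /cvgr0Pnorm_lt /(_ _ r20).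
  by apply: filterS => y; rewrite normrZ.
have near_seg (t : R) : `|t| <= `|c k h| -> ball_ Num.Def.normr x r (x + a + t *: e k).
  move=> tc; rewrite /ball_/= opprD addrA opprD addrA subrr sub0r -opprD normrN.
  rewrite (le_lt_trans (ler_normD _ _))// [ltRHS]splitr ltrD// normrZ.
  by rewrite (le_lt_trans _ nk)// ler_wpM2r.
have [t tc ft] := @MVT_line R E f (x + a) (e k) (c k h)
  (fun t tc => (rP _ (near_seg t tc)).1).
have -> : c k h *: e k + x + a = x + a + c k h *: e k.
  by rewrite -addrA addrC.
rewrite -(subrK (f (x + a)) (f (x + a + _))) ft.
have -> : c k h * 'D_(e k) f (x + a + t *: e k) + f (x + a) - f x -
   (c k h * 'D_(e k) f x + \sum_(j <- s) c j h * 'D_(e j) f x) =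
   (f (x + a) - f x - \sum_(j <- s) c j h * 'D_(e j) f x)
   - c k h * ('D_(e k) f x - 'D_(e k) f (x + a + t *: e k)).
  by rewrite mulrBr; lra.
rewrite (le_trans (ler_normB _ _))// [eps]splitr mulrDl lerD//.
  by rewrite /a; near: h; exact: IHs.
rewrite normrM; have := (rP _ (near_seg t tc)).2 => Dle.
rewrite (le_trans (ler_pM _ _ (Cc h) Dle))//.
by rewrite mulrAC (mulrC C) divfK// gt_eqF.
Unshelve. all: by end_near. Qed.

Lemma C1_differentiable E F (f : E -> F) (x : E) : has_coords E -> has_coords F ->
  (forall v, \near x, derivable f x v) ->
  (forall v, {for x, continuous ('D_v f)}) -> differentiable f x.
Proof.
move=> cE [I [e [c [cc ce]]]] df Dfc; apply: (differentiable_coords ce) => k.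
apply: C1_differentiable_scalar => // v.
  by apply: filterS (df v) => y dfy; have [] := linear_is_derive (cc k) dfy.
apply: (@near_eq_continuous _ _ (c k \o 'D_v f)).
  apply: filterS (df v) => y dfy.
  by have [_ ->] := linear_is_derive (cc k) dfy.
by apply: continuous_comp; [exact: Dfc|exact: cc].
Qed.

(** Schwarz's theorem for two fixed directions. The mean value theorem requires scalar values;
    [smooth_on_derive_comm] passes to vector values by coordinates. *)
Lemma derive_comm_scalar E (f : E -> R) (x u v : E) :
  (\near x, derivable f x u) -> (\near x, derivable f x v) ->
  (\near x, derivable ('D_u f) x v) -> (\near x, derivable ('D_v f) x u) ->
  {for x, continuous ('D_u ('D_v f))} -> {for x, continuous ('D_v ('D_u f))} ->
  'D_u ('D_v f) x = 'D_v ('D_u f) x.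
Proof.
move=> fu fv fuv fvu cuv cvu.
apply/eqP; rewrite -subr_eq0 -normr_le0; apply/ler_addgt0Pr => eps eps0.
rewrite add0r; have eps20 : 0 < eps / 2 by rewrite divr_gt0.
have : \forall y \near x, [/\ derivable f y u, derivable f y v,
    derivable ('D_u f) y v, derivable ('D_v f) y u &
    `|'D_u ('D_v f) x - 'D_u ('D_v f) y| <= eps / 2 /\
    `|'D_v ('D_u f) x - 'D_v ('D_u f) y| <= eps / 2].
  have c1 : \forall y \near x, `|'D_u ('D_v f) x - 'D_u ('D_v f) y| <= eps / 2.
    by move: cuv => /cvgrPdist_le; apply.
  have c2 : \forall y \near x, `|'D_v ('D_u f) x - 'D_v ('D_u f) y| <= eps / 2.
    by move: cvu => /cvgrPdist_le; apply.
  apply: filterS (filterI (filterI fu fv) (filterI (filterI fuv fvu)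
    (filterI c1 c2))) => y [[? ?] [[? ?] [? ?]]].
  by split.
move=> /nbhs_normP[r /= r0 rP].
(* [K] exceeds [|u| + |v|] and stays positive when both vanish, so all points [x + s u + s' v] with
   [|s|, |s'| <= t] lie in the ball of radius [r]. *)
pose K := `|u| + `|v| + 1; have K0 : 0 < K by rewrite ltr_wpDl ?addr_ge0.
pose t := r / (2 * K); have t0 : 0 < t by rewrite divr_gt0// mulr_gt0.
have tu (s s' : R) : `|s| <= `|t| -> `|s'| <= `|t| ->
    ball_ Num.Def.normr x r (x + s *: u + s' *: v).
  move=> st s't; rewrite /ball_/= -addrA opprD addNKr normrN.
  rewrite (le_lt_trans (ler_normD _ _))// !normrZ.
  rewrite (@le_lt_trans _ _ (`|t| * `|u| + `|t| * `|v|))//.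
    by rewrite lerD// ler_wpM2r.
  rewrite -mulrDr gtr0_norm//.
  rewrite (@lt_le_trans _ _ (t * (2 * K)))//; last first.
    by rewrite /t divfK// gt_eqF// mulr_gt0.
  by rewrite ltr_pM2l// /K; have := normr_ge0 u; have := normr_ge0 v; lra.
have le00 : `|0 : R| <= `|t| by rewrite normr0.
(* The second difference of [f] on the parallelogram spanned by [t u] and [t v]
   is evaluated by the mean value theorem in both orders. *)
have half (a b : E) : (forall s s' : R, `|s| <= `|t| -> `|s'| <= `|t| ->
      ball_ Num.Def.normr x r (x + s *: a + s' *: b)) ->
    (forall y, ball_ Num.Def.normr x r y -> derivable f y b) ->
    (forall y, ball_ Num.Def.normr x r y -> derivable ('D_b f) y a) ->
    exists2 y, ball_ Num.Def.normr x r y &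
      f (x + t *: a + t *: b) - f (x + t *: a) - (f (x + t *: b) - f x) =
      t * t * 'D_a ('D_b f) y.
  move=> tab fb fba.
  have gb (s : R) : `|s| <= `|t| ->
      is_derive (x + s *: b) b (fun z => f (z + t *: a) - f z)
        ('D_b f (x + t *: a + s *: b) - 'D_b f (x + s *: b)).
    move=> st; apply: is_deriveB; last first.
      apply: derivableP; apply: fb.
      by have := tab 0 s le00 st; rewrite scale0r addr0.
    have fd : derivable f (x + t *: a + s *: b) b.
      by apply: fb; exact: tab.
    have E1 : (fun h : R => h^-1 *: (((fun z : E => f (z + t *: a)) \o shift (x + s *: b))
      (h *: b) - f (x + s *: b + t *: a))) =
      (fun h : R => h^-1 *: ((f \o shift (x + t *: a + s *: b)) (h *: b) -
        f (x + t *: a + s *: b))).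
      apply/funext => h /=; rewrite (addrAC x (s *: b)).
      by rewrite -(addrA (h *: b)) (addrAC x (s *: b)).
    split; rewrite /derivable /derive E1; [exact: fd|by []].
  have [s st eqs] := @MVT_line R E (fun z => f (z + t *: a) - f z) x b t
     (fun s st => @ex_derive _ _ _ _ _ _ _ (gb s st)).
  have [|s' s't eqs'] := @MVT_line R E ('D_b f) (x + s *: b) a t.
    by move=> s' s't; apply: fba; rewrite addrAC; exact: tab.
  exists (x + s *: b + s' *: a); first by rewrite addrAC; exact: tab.
  move: eqs; have [_ ->] := gb _ st.
  rewrite (addrAC x (t *: a) (s *: b)) eqs' => eqs.
  by rewrite -(addrAC x (t *: b)) -mulrA -eqs; ring.
(* The second difference is symmetric in the two directions. *)
have swap (a b c d : R) : a - b - (c - d) = a - c - (b - d).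
  by rewrite !opprB addrACA [in RHS]addrACA [- b - c]addrC.
have [y yP ey] := half u v tu (fun y yr => let: And5 _ h _ _ _ := rP _ yr in h)
  (fun y yr => let: And5 _ _ _ h _ := rP _ yr in h).
have tv (s s' : R) : `|s| <= `|t| -> `|s'| <= `|t| ->
    ball_ Num.Def.normr x r (x + s *: v + s' *: u).
  by move=> st s't; rewrite addrAC; exact: tu.
have [z zP ez] := half v u tv (fun y yr => let: And5 h _ _ _ _ := rP _ yr in h)
  (fun y yr => let: And5 _ _ h _ _ := rP _ yr in h).
have tt0 : t * t != 0 by rewrite mulf_neq0// gt_eqF.
(* The mixed derivatives agree at two different points [y] and [z], where each is within [eps / 2]
   of its value at [x]. *)
have yz : 'D_u ('D_v f) y = 'D_v ('D_u f) z.
  by apply: (mulfI tt0); rewrite -ey -ez (addrAC x (t *: v)) swap.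
have [_ _ _ _ [yu _]] := rP _ yP; have [_ _ _ _ [_ zv]] := rP _ zP.
rewrite yz in yu.
have -> : 'D_u ('D_v f) x - 'D_v ('D_u f) x =
  ('D_u ('D_v f) x - 'D_v ('D_u f) z) - ('D_v ('D_u f) x - 'D_v ('D_u f) z).
  by rewrite opprB addrA subrK.
apply: (le_trans (ler_normB _ _)); rewrite (splitr eps).
exact: lerD yu zv.
Unshelve. all: by end_near. Qed.

End ContinuouslyDifferentiable.

Section Coordinates.
Context {R : realType}.
Implicit Types E F G : normedModType R.

Lemma has_coords_scalar : has_coords R.
Proof.
exists unit, (fun=> 1), (fun=> idfun); split=> [_ x|h]; first exact: cvg_id.
by rewrite big_const card_unit/= addr0 [_ *: _]mulr1.
Qed.

Lemma has_coords_mx m n : has_coords 'M[R]_(m, n).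
Proof.
have linc (ij : 'I_m * 'I_n) : linear (fun M : 'M[R]_(m, n) => M ij.1 ij.2 : R).
  by move=> a u v; rewrite !mxE.
pose c ij : {linear 'M[R]_(m, n) -> R} :=
  HB.pack (fun M : 'M[R]_(m, n) => M ij.1 ij.2 : R)
    (GRing.isLinear.Build _ _ _ _ _ (linc ij)).
exists ('I_m * 'I_n)%type, (fun ij => delta_mx ij.1 ij.2), c.
split=> [ij M|h]; first exact: coord_continuous.
by rewrite {1}(matrix_sum_delta h) pair_big.
Qed.

Lemma has_coords_prod E F : has_coords E -> has_coords F -> has_coords (E * F)%type.
Proof.
move=> [I [e [c [cc ce]]]] [J [f [d [dc df]]]].
have linc (k : I + J) : linear (fun p : E * F =>
    match k with inl i => c i p.1 | inr j => d j p.2 end : R).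
  by case: k => k a u v; rewrite /= linearP.
pose cd k : {linear (E * F)%type -> R} := HB.pack (fun p : E * F =>
    match k with inl i => c i p.1 | inr j => d j p.2 end : R)
    (GRing.isLinear.Build _ _ _ _ _ (linc k)).
exists (I + J)%type,
  (fun k => match k with inl i => (e i, 0) | inr j => (0, f j) end), cd.
split=> [[k|k] p|[h1 h2]] /=.
- by apply: continuous_comp; [exact: cvg_fst|exact: cc].
- by apply: continuous_comp; [exact: cvg_snd|exact: dc].
rewrite big_sumType/= [RHS]surjective_pairing/=; congr pair.
  rewrite [h1 in LHS]ce !(big_morph fst (fun _ _ => erefl) erefl)/=.
  rewrite [X in _ + X]big1 ?addr0//.
  by move=> j _; rewrite scaler0.
rewrite [h2 in LHS]df !(big_morph snd (fun _ _ => erefl) erefl)/=.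
rewrite [X in X + _]big1 ?add0r//.
by move=> j _; rewrite scaler0.
Qed.

Lemma differentiable_scale E F (k : E -> R) (f : E -> F) (x : E) : has_coords F ->
  differentiable k x -> differentiable f x ->
  differentiable (fun y => k y *: f y) x.
Proof.
move=> [I [e [c [cc ce]]]] dk df; apply: (differentiable_coords ce) => i.
rewrite (_ : _ \o _ = fun y => k y * (c i \o f) y); last first.
  by apply/funext => y /=; rewrite linearZ.
apply: differentiableM => //; apply: differentiable_comp => //.
exact: linear_differentiable.
Qed.

(** Derivability of [k] along [v] gives its continuity along the line through [x], which is all that
    the difference quotient of the product uses. *)
Lemma is_derive_scale E F (k : E -> R) (f : E -> F) (x v : E) (dk : R) (df : F) :
  is_derive x v k dk -> is_derive x v f df ->
  is_derive x v (fun y => k y *: f y) (k x *: df + dk *: f x).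
Proof.
move=> [kxv <-] [fxv <-].
suff key : (fun h : R => h^-1 *: (((fun y => k y *: f y) \o shift x) (h *: v) -
   k x *: f x)) @ 0^' --> k x *: 'D_v f x + 'D_v k x *: f x.
  by split; [apply/cvg_ex; eexists; exact: key|exact: cvg_lim key].
rewrite (_ : (fun _ => _) = fun h : R =>
   (k \o shift x) (h *: v) *: (h^-1 *: ((f \o shift x) (h *: v) - f x)) +
   (h^-1 *: ((k \o shift x) (h *: v) - k x)) *: f x); last first.
  apply/funext => h /=; rewrite !scalerA mulrC -!scalerA -scalerDr; congr (_ *: _).
  by rewrite scalerBr scalerBl addrA subrK.
apply: cvgD; last by apply: cvgZr_tmp; exact: kxv.
apply: cvgZ; last exact: fxv.
move/derivable1P/derivable1_diffP/differentiable_continuous : kxv.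
rewrite /prop_for /continuous_at/= scale0r add0r => kc.
by apply: cvg_trans kc; apply: cvg_app; exact: nbhs_dnbhs.
Qed.

Lemma smooth_on_derive E F (U : set E) (f : E -> F) (v : E) :
  smooth_on U f -> smooth_on U ('D_v f).
Proof. by move=> sf k; have [_ /(_ v)[]] := sf k.+1. Qed.

Lemma smooth_on_derivable E F (U : set E) (f : E -> F) (x v : E) :
  smooth_on U f -> U x -> derivable f x v.
Proof. by move=> sf Ux; have [_ /(_ v)[+ _]] := sf 1; apply. Qed.

Lemma smooth_on_continuous E F (U : set E) (f : E -> F) (x : E) :
  smooth_on U f -> U x -> {for x, continuous f}.
Proof. by move=> sf Ux; have [+ _] := sf 0; apply. Qed.

Lemma smooth_on_differentiable E F (U : set E) (f : E -> F) (x : E) :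
  has_coords E -> has_coords F -> open U -> U x -> smooth_on U f ->
  differentiable f x.
Proof.
move=> cE cF oU Ux sf; apply: C1_differentiable => // v; last first.
  exact: smooth_on_continuous (smooth_on_derive v sf) Ux.
have : nbhs x U by apply: open_nbhs_nbhs.
by apply: filterS => y; exact: smooth_on_derivable sf.
Qed.

Lemma smooth_on_derive_comm E F (U : set E) (f : E -> F) (x u v : E) :
  has_coords E -> has_coords F -> open U -> U x -> smooth_on U f ->
  'D_u ('D_v f) x = 'D_v ('D_u f) x.
Proof.
move=> cE [I [e [c [cc ce]]]] oU Ux sf.
have nU : nbhs x U by exact: open_nbhs_nbhs.
rewrite [LHS]ce [RHS]ce; apply: eq_bigr => k _; congr (_ *: _).
have Dc w y : U y -> is_derive y w (c k \o f) (c k ('D_w f y)).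
  by move=> Uy; apply: linear_is_derive => //; exact: smooth_on_derivable sf Uy.
have nDc w (y : E) : U y -> \near y, c k ('D_w f y) = 'D_w (c k \o f) y.
  move=> Uy; have : nbhs y U by exact: open_nbhs_nbhs.
  by apply: filterS => z /(Dc w) [_ ->].
have DDc w w' y : U y ->
    is_derive y w' ('D_w (c k \o f)) (c k ('D_w' ('D_w f) y)).
  move=> Uy; apply: (near_eq_is_derive (nDc w y Uy)).
  by apply: linear_is_derive => //; exact: smooth_on_derivable (smooth_on_derive w sf) Uy.
have DDcc w w' : {for x, continuous ('D_w' ('D_w (c k \o f)))}.
  apply: (@near_eq_continuous _ _ _ (c k \o 'D_w' ('D_w f))).
    by apply: filterS nU => y /(DDc w w') [_ ->].
  apply: continuous_comp; last exact: cc.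
  exact: smooth_on_continuous (smooth_on_derive w' (smooth_on_derive w sf)) Ux.
have [_ <-] := DDc v u _ Ux; have [_ <-] := DDc u v _ Ux.
apply: derive_comm_scalar => //.
- by apply: filterS nU => y /(Dc u) [].
- by apply: filterS nU => y /(Dc v) [].
- by apply: filterS nU => y /(DDc u v) [].
- by apply: filterS nU => y /(DDc v u) [].
Qed.

Lemma derive_coords E F (I : finType) (e : I -> E) (c : I -> {linear E -> R})
    (f : E -> F) (x v : E) : (forall h, h = \sum_k c k h *: e k) ->
  differentiable f x -> 'D_v f x = \sum_k c k v *: 'D_(e k) f x.
Proof.
move=> ce df; rewrite deriveE// {1}(ce v) linear_sum; apply: eq_bigr => k _.
by rewrite linearZ/= deriveE.
Qed.

(** The direction varies with the point, so it is expanded in coordinates: only derivatives of [f]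
    in fixed directions remain, and these are smooth again. This serves both iterated Lie
    derivatives and the frame component of the transitions of GL(M). *)
Lemma differentiable_derive_along E F G (U : set F) (f : F -> G) (b w : E -> F)
    (x : E) : has_coords F -> has_coords G -> open U -> U (b x) ->
  smooth_on U f -> differentiable b x -> differentiable w x ->
  differentiable (fun y => 'D_(w y) f (b y)) x.
Proof.
move=> cF cG oU Ux sf db dw.
have [I [e [c [cc ce]]]] := cF.
apply: (@near_differentiable _ _ _
    (fun y => \sum_k c k (w y) *: 'D_(e k) f (b y))).
  have nU : nbhs (b x) U by exact: open_nbhs_nbhs.
  have nV : \forall y \near x, U (b y) := differentiable_continuous db nU.
  apply: filterS nV => y Uy.
  by rewrite (derive_coords _ ce)//; exact: smooth_on_differentiable sf.
apply: differentiable_fsum => k; apply: differentiable_scale => //.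
  by apply: (@differentiable_comp _ _ _ _ w (c k)) => //; exact: linear_differentiable.
apply: (@differentiable_comp _ _ _ _ b ('D_(e k) f)) => //.
exact: smooth_on_differentiable (smooth_on_derive _ sf).
Qed.

End Coordinates.

(** * Matrix-valued maps and matrices of linear maps *)

Section MatrixCalculus.
Context {R : realType}.
Implicit Types E : normedModType R.

Lemma differentiable_fprod E (I : finType) (f : I -> E -> R) (x : E) :
  (forall i, differentiable (f i) x) ->
  differentiable (fun y => \prod_i f i y) x.
Proof.
move=> df; elim: (index_enum I) => [|i s IHs].
  by under eq_fun do rewrite big_nil; exact: differentiable_cst.
by under eq_fun do rewrite big_cons; exact: differentiableM.
Qed.

Lemma differentiable_mx E m n (f : E -> 'M[R]_(m, n)) (x : E) :
  (forall i j, differentiable (fun y => f y i j) x) -> differentiable f x.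
Proof.
move=> df; rewrite (_ : f = fun y => \sum_(ij : 'I_m * 'I_n)
    f y ij.1 ij.2 *: delta_mx ij.1 ij.2); last first.
  by apply/funext => y; rewrite {1}(matrix_sum_delta (f y)) pair_big.
by apply: differentiable_fsum => ij; exact: differentiableZl.
Qed.

Lemma differentiable_entry E m n (f : E -> 'M[R]_(m, n)) (x : E) i j :
  differentiable f x -> differentiable (fun y => f y i j) x.
Proof.
move=> df; apply: (@differentiable_comp _ _ _ _ f (fun N => N i j)) => //.
exact: differentiable_coord.
Qed.

Lemma differentiable_mulmx E m n p (f : E -> 'M[R]_(m, n)) (g : E -> 'M[R]_(n, p))
    (x : E) : differentiable f x -> differentiable g x ->
  differentiable (fun y => f y *m g y) x.
Proof.
move=> df dg; apply: differentiable_mx => i j.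
under eq_fun do rewrite mxE; apply: differentiable_fsum => k.
by apply: differentiableM; exact: differentiable_entry.
Qed.

Lemma differentiable_trmx E m n (f : E -> 'M[R]_(m, n)) (x : E) :
  differentiable f x -> differentiable (fun y => (f y)^T) x.
Proof.
move=> df; apply: differentiable_mx => i j.
by under eq_fun do rewrite mxE; exact: differentiable_entry.
Qed.

Lemma differentiable_det E n (f : E -> 'M[R]_n) (x : E) :
  differentiable f x -> differentiable (fun y => \det (f y)) x.
Proof.
move=> df; apply: differentiable_fsum => s.
apply: differentiableM; first exact: differentiable_cst.
by apply: differentiable_fprod => i; exact: differentiable_entry.
Qed.

Lemma near_unitmx E n (f : E -> 'M[R]_n) (x : E) :
  differentiable f x -> f x \in unitmx -> \near x, f x \in unitmx.
Proof.
move=> df; rewrite unitmxE unitfE => fx0.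
have := differentiable_continuous (differentiable_det df).
move=> /cvgr_neq0 /(_ fx0); apply: filterS => y.
by rewrite unitmxE unitfE.
Qed.

(** Cramer's formula. [invmx] follows it only at invertible matrices, which is why the argument
    stays near [x]. *)
Lemma differentiable_invmx E n (f : E -> 'M[R]_n) (x : E) :
  differentiable f x -> f x \in unitmx -> differentiable (fun y => invmx (f y)) x.
Proof.
move=> df fx.
apply: (@near_differentiable _ _ _ (fun y => (\det (f y))^-1 *: \adj (f y))).
  by apply: filterS (near_unitmx df fx) => y fy; rewrite /invmx fy.
apply: differentiable_mx => i j; under eq_fun do rewrite !mxE.
apply: differentiableM.
  apply: differentiableV; first exact: differentiable_det.
  by move: fx; rewrite unitmxE unitfE.
apply: differentiableM; first exact: differentiable_cst.
apply: differentiable_det; apply: differentiable_mx => k l.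
by under eq_fun do rewrite !mxE; exact: differentiable_entry.
Qed.

Lemma is_derive_entry E m n (f : E -> 'M[R]_(m, n)) (x v : E) (df : 'M[R]_(m, n)) i j :
  is_derive x v f df -> is_derive x v (fun y => f y i j) (df i j).
Proof.
move=> [fxv <-]; split; first by move/derivable_mxP : fxv; exact.
by rewrite derive_mx// mxE.
Qed.

Lemma is_derive_mx E m n (f : E -> 'M[R]_(m, n)) (x v : E) (df : 'M[R]_(m, n)) :
  (forall i j, is_derive x v (fun y => f y i j) (df i j)) -> is_derive x v f df.
Proof.
move=> fdf.
have fxv : derivable f x v by apply/derivable_mxP => i j; have [] := fdf i j.
split=> //; apply/matrixP => i j; rewrite derive_mx// mxE.
by have [] := fdf i j.
Qed.

Lemma is_derive_fsum E (F : normedModType R) n (f : 'I_n -> E -> F) (x v : E)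
    (df : 'I_n -> F) : (forall i, is_derive x v (f i) (df i)) ->
  is_derive x v (fun y => \sum_i f i y) (\sum_i df i).
Proof.
move=> fdf; rewrite (_ : (fun _ => _) = \sum_i f i); last first.
  by apply/funext => y; rewrite fct_sumE.
exact: is_derive_sum.
Qed.

Lemma is_derive_mulmx E m n p (f : E -> 'M[R]_(m, n)) (g : E -> 'M[R]_(n, p))
    (x v : E) (df : 'M[R]_(m, n)) (dg : 'M[R]_(n, p)) :
  is_derive x v f df -> is_derive x v g dg ->
  is_derive x v (fun y => f y *m g y) (f x *m dg + df *m g x).
Proof.
move=> fdf gdg; apply: is_derive_mx => i j.
under eq_fun do rewrite mxE.
rewrite !mxE -big_split/=; apply: is_derive_fsum => k.
have fk := is_derive_entry i k fdf; have gk := is_derive_entry k j gdg.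
by have := is_deriveM fk gk; rewrite [g x k j *: _]mulrC.
Qed.

(** [comp_cols L 1%:M] is the matrix of [L]. Linearity is a hypothesis because the derivatives fed
    to [comp_cols] are mere functions, known to be linear where the map is differentiable. *)
Lemma comp_colsE n (L : 'cV[R]_n -> 'cV[R]_n) (a : 'M[R]_n) : linear L ->
  comp_cols L a = comp_cols L 1%:M *m a.
Proof.
move=> linL; pose LL : {linear 'cV[R]_n -> 'cV[R]_n} :=
  HB.pack L (GRing.isLinear.Build _ _ _ _ _ linL).
apply/matrixP => i k; rewrite !mxE -[L]/(LL : _ -> _).
have {1}-> : col k a = \sum_j a j k *: col j 1%:M.
  apply/colP => l; rewrite mxE summxE (bigD1 l)//= big1 ?addr0; last first.
    by move=> j jl; rewrite !mxE eq_sym (negbTE jl) mulr0.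
  by rewrite !mxE eqxx mulr1.
rewrite linear_sum summxE; apply: eq_bigr => j _.
by rewrite linearZ !mxE mulrC.
Qed.

Lemma comp_cols_comp n (K L : 'cV[R]_n -> 'cV[R]_n) (a : 'M[R]_n) :
  comp_cols K (comp_cols L a) = comp_cols (K \o L) a.
Proof.
apply/matrixP => i k; rewrite !mxE; congr (K _ _ _).
by apply/colP => j; rewrite !mxE.
Qed.

Lemma comp_cols_id n (L : 'cV[R]_n -> 'cV[R]_n) (a : 'M[R]_n) :
  (forall v, L v = v) -> comp_cols L a = a.
Proof. by move=> Lid; apply/matrixP => i k; rewrite mxE Lid mxE. Qed.

Lemma comp_cols_mul n (L : 'cV[R]_n -> 'cV[R]_n) (v : 'cV[R]_n) : linear L ->
  comp_cols L 1%:M *m v = L v.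
Proof.
move=> linL; pose LL : {linear 'cV[R]_n -> 'cV[R]_n} :=
  HB.pack L (GRing.isLinear.Build _ _ _ _ _ linL).
have {2}-> : v = \sum_j v j 0 *: col j 1%:M.
  apply/colP => l; rewrite summxE (bigD1 l)//= big1 ?addr0; last first.
    by move=> j jl; rewrite !mxE eq_sym (negbTE jl) mulr0.
  by rewrite !mxE eqxx mulr1.
rewrite -[L]/(LL : _ -> _) linear_sum; apply/colP => i.
rewrite mxE summxE; apply: eq_bigr => j _.
by rewrite linearZ !mxE mulrC.
Qed.

Lemma comp_cols_unit n (K L : 'cV[R]_n -> 'cV[R]_n) : linear K -> linear L ->
  (forall v, K (L v) = v) -> comp_cols L 1%:M \in unitmx.
Proof.
move=> linK linL KL; have : comp_cols K 1%:M *m comp_cols L 1%:M = 1%:M.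
  by rewrite -comp_colsE// comp_cols_comp comp_cols_id.
by case/mulmx1_unit.
Qed.

End MatrixCalculus.

(** * Atlases and symbols *)

Section LinearSmooth.
Context {R : realType}.
Implicit Types E F : normedModType R.

Lemma near_eq_in_open E F (U : set E) (f g : E -> F) (x : E) : open U ->
  (forall y, U y -> f y = g y) -> U x -> \near x, f x = g x.
Proof.
move=> oU fg Ux; have nU : nbhs x U by exact: open_nbhs_nbhs.
exact: filterS nU.
Qed.

(** Agreement on [U] rather than everywhere is what the induction preserves: the derivative of [f]
    is known to vanish on [U] only. *)
Lemma smooth_on_cst E F (U : set E) (f : E -> F) (a : F) : open U ->
  (forall y, U y -> a = f y) -> smooth_on U f.
Proof.
move=> oU + k; elim: k a f => [|k IHk] a f fa; split=> //.
- move=> x Ux; apply: (near_eq_continuous (near_eq_in_open oU fa Ux)).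
  exact: cvg_cst.
- move=> x Ux; apply: (near_eq_continuous (near_eq_in_open oU fa Ux)).
  exact: cvg_cst.
- move=> v; have fv x : U x -> is_derive x v f 0.
    by move=> Ux; apply: near_eq_is_derive (near_eq_in_open oU fa Ux) _.
  split=> [x /fv[]//|]; apply: (IHk 0) => y /fv[_ ->//].
Qed.

Lemma smooth_on_linear E F (U : set E) (f : E -> F) (l : {linear E -> F}) :
  open U -> continuous l -> (forall y, U y -> l y = f y) -> smooth_on U f.
Proof.
move=> oU lc lf; have fc x : U x -> {for x, continuous f}.
  move=> Ux; apply: (near_eq_continuous (near_eq_in_open oU lf Ux)).
  exact: lc.
case=> [//|k]; split=> // v; have fv x : U x -> is_derive x v f (l v).
  move=> Ux; apply: near_eq_is_derive (near_eq_in_open oU lf Ux) _.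
  apply: diff_derive; first exact: linear_differentiable.
  by rewrite diff_lin.
split=> [x /fv[]//|]; apply: (@smooth_on_cst _ _ U _ (l v)) => //.
by move=> y /fv[_ ->].
Qed.

End LinearSmooth.

Section Atlas.
Context {R : realType} {E : normedModType R}.

(* The part of [smooth_manifold] that the calculus below relies on; the frame
   bundle has it as well. *)
Record differentiable_atlas (M : charted E) : Prop := DifferentiableAtlas {
  atlas_dom : forall x : M, dom (at_ x) x;
  atlas_fwdK : forall (i : idx M) x, dom i x -> bwd i (fwd i x) = x;
  atlas_open : forall i j : idx M, open (fwd i @` (dom i `&` dom j));
  atlas_diff : forall (i j : idx M) y, (fwd i @` (dom i `&` dom j)) y ->
    differentiable (fwd j \o bwd i) y }.

Variable M : charted E.
Hypothesis atM : differentiable_atlas M.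
Hypothesis coordsE : has_coords E.
Local Notation domP := (atlas_dom atM).
Local Notation bwdK := (atlas_fwdK atM).

Lemma near_chart (i j : idx M) (x : M) : dom i x -> dom j x ->
  \forall y \near fwd i x,
    [/\ dom i (bwd i y), dom j (bwd i y) & fwd i (bwd i y) = y].
Proof.
move=> ix jx; have : nbhs (fwd i x) (fwd i @` (dom i `&` dom j)).
  by apply: open_nbhs_nbhs; split; [exact: atlas_open|exists x].
by apply: filterS => _ [z [iz jz] <-]; rewrite bwdK.
Qed.

Lemma transition_differentiable (i j : idx M) (x : M) : dom i x -> dom j x ->
  differentiable (fwd j \o bwd i) (fwd i x).
Proof. by move=> ix jx; apply: atlas_diff => //; exists x. Qed.

Lemma change_chart (F : normedModType R) (f : M -> F) (i j : idx M) (x : M) :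
  dom i x -> dom j x -> differentiable (f \o bwd i) (fwd i x) ->
  differentiable (f \o bwd j) (fwd j x) /\
  forall v, 'd (f \o bwd j) (fwd j x) v =
    'd (f \o bwd i) (fwd i x) ('d (fwd i \o bwd j) (fwd j x) v).
Proof.
move=> ix jx df; have dt := transition_differentiable jx ix.
have df' : differentiable (f \o bwd i) ((fwd i \o bwd j) (fwd j x)).
  by rewrite /= bwdK.
have fE : \forall y \near fwd j x, ((f \o bwd i) \o (fwd i \o bwd j)) y = (f \o bwd j) y.
  by apply: filterS (near_chart jx ix) => y [_ iy _]; rewrite /= bwdK.
have [dfj ->] := near_eq_differentiable fE (differentiable_comp dt df').
by split=> // v; rewrite diff_comp//= bwdK.
Qed.

Lemma transition_cancel (i j : idx M) (x : M) (v : E) : dom i x -> dom j x ->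
  'd (fwd i \o bwd j) (fwd j x) ('d (fwd j \o bwd i) (fwd i x) v) = v.
Proof.
move=> ix jx.
have [_ <-] := change_chart jx ix (transition_differentiable jx ix).
have nid : \forall y \near fwd i x, idfun y = (fwd i \o bwd i) y.
  by apply: filterS (near_chart ix ix) => y [_ _] /= ->.
have [_ ->] := near_eq_differentiable nid (@ex_diff _ _ _ _ _ _ _ (is_diff_id (fwd i x))).
by rewrite diff_val.
Qed.

Lemma differentiable_atP (F : normedModType R) (f : M -> F) (i : idx M) (x : M) :
  dom i x -> differentiable_at x f <-> differentiable (f \o bwd i) (fwd i x).
Proof.
move=> ix; split=> df.
  by have [] := change_chart (domP x) ix df.
by have [] := change_chart ix (domP x) df.
Qed.

Lemma dfun_fwd (i : idx M) (x : M) (v : E) : dom i x ->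
  dfun (fwd i) x v = 'd (fwd i \o bwd (at_ x)) (fwd (at_ x) x) v.
Proof.
move=> ix; rewrite /dfun deriveE//.
exact: transition_differentiable (domP x) ix.
Qed.

Lemma derive_transition_id (i : idx M) (x : M) (v : E) : dom i x ->
  'D_v (fwd i \o bwd i) (fwd i x) = v.
Proof.
move=> ix; have -> : v = 'D_v idfun (fwd i x) by rewrite derive_id.
rewrite {1}derive_id; apply: near_eq_derive.
by apply: filterS (near_chart ix ix) => y [_ _] /= ->.
Qed.

Lemma dfun_fwd_at (x : M) (v : E) : dfun (fwd (at_ x)) x v = v.
Proof. exact: derive_transition_id (domP x). Qed.

(** [dfun (fwd i) x v] is the tangent vector [v] read in the chart [i], so [dfun] can be computed in
    any chart around [x]. *)
Lemma dfunE (F : normedModType R) (f : M -> F) (i : idx M) (x : M) (v : E) :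
  dom i x -> differentiable_at x f ->
  dfun f x v = 'd (f \o bwd i) (fwd i x) (dfun (fwd i) x v).
Proof.
move=> ix df; rewrite dfun_fwd// /dfun deriveE//.
by have [_] := change_chart ix (domP x) ((differentiable_atP f ix).1 df).
Qed.

Lemma dfun_linear (F : normedModType R) (f : M -> F) (x : M) :
  differentiable_at x f -> linear (dfun f x).
Proof. by move=> df a u v; rewrite /dfun !deriveE// linearP. Qed.

Lemma dfun_near_eq (F : normedModType R) (f g : M -> F) (x : M) (v : E) :
  (\forall y \near fwd (at_ x) x, f (bwd (at_ x) y) = g (bwd (at_ x) y)) ->
  dfun f x v = dfun g x v.
Proof. exact: near_eq_derive. Qed.

Lemma smooth_differentiable_at (F : normedModType R) (f : M -> F) (x : M) :
  has_coords F -> smooth_at x f -> differentiable_at x f.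
Proof.
move=> cF [U [oO Ox] sf]; exact: smooth_on_differentiable sf.
Qed.

(** Smoothness at [x] is expressed in the chart [at_ x], differentiability at a nearby point in the
    preferred chart of that point; the transition map connects the two. *)
Lemma near_smooth_differentiable (F : normedModType R) (f : M -> F) (x : M) :
  has_coords F -> smooth_at x f ->
  \forall y \near fwd (at_ x) x, differentiable_at (bwd (at_ x) y) f.
Proof.
move=> cF [U [oO Ox] sf].
have nO : nbhs (fwd (at_ x) x) U by exact: open_nbhs_nbhs.
apply: filterS2 nO (near_chart (domP x) (domP x)) => y Oy [iy _ yK].
apply/(differentiable_atP _ iy); rewrite yK.
exact: smooth_on_differentiable sf.
Qed.

(** Near [x], [lieD W f] is the derivative of [f] in the chart [at_ x] along the local expression of
    [W], which replaces the possibly jumping values of [W]. *)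
Lemma differentiable_lieD (W : vfield M) (f : M -> R) (x : M) :
  smooth_at x f -> differentiable_at x (lieD W (fwd (at_ x))) ->
  differentiable_at x (lieD W f).
Proof.
move=> sf dW; have [U [oO Ox] sfO] := sf.
apply: (@near_differentiable _ _ _ (fun y =>
  'D_((lieD W (fwd (at_ x)) \o bwd (at_ x)) y) (f \o bwd (at_ x)) y)); last first.
  apply: (@differentiable_derive_along _ _ _ _ U _ idfun) => //.
  exact: has_coords_scalar.
have nO : nbhs (fwd (at_ x) x) U by exact: open_nbhs_nbhs.
apply: filterS2 nO (filterI (near_chart (domP x) (domP x))
  (near_smooth_differentiable has_coords_scalar sf)) => y Oy [[iy _ yK] dfy].
rewrite /= [RHS]/lieD (dfunE _ iy)// yK deriveE//.
by rewrite -[y in differentiable _ y]yK; apply/differentiable_atP.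
Qed.

Lemma is_derive_dfun (f : M -> R) (x : M) (v : E) : differentiable_at x f ->
  is_derive (fwd (at_ x) x) v (f \o bwd (at_ x)) (dfun f x v).
Proof. by move=> df; apply/derivableP/diff_derivable. Qed.

Lemma dfunM (f g : M -> R) (x : M) (v : E) :
  differentiable_at x f -> differentiable_at x g ->
  dfun (fun y => f y * g y) x v = f x * dfun g x v + g x * dfun f x v.
Proof.
move=> /(is_derive_dfun v) df /(is_derive_dfun v) dg.
have [_] := is_deriveM df dg; rewrite /= bwdK; last exact: domP.
exact.
Qed.

Lemma dfunD (f g : M -> R) (x : M) (v : E) :
  differentiable_at x f -> differentiable_at x g ->
  dfun (fun y => f y + g y) x v = dfun f x v + dfun g x v.
Proof.
move=> /(is_derive_dfun v) df /(is_derive_dfun v) dg.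
by have [_] := is_deriveD df dg.
Qed.

Lemma differentiable_atM (f g : M -> R) (x : M) :
  differentiable_at x f -> differentiable_at x g ->
  differentiable_at x (fun y => f y * g y).
Proof. exact: differentiableM. Qed.

(** The cross term is what the symbol retains; the terms with an undifferentiated factor cancel
    there. *)
Lemma lieD_lieD_mul (W : vfield M) (f g : M -> R) (x : M) :
  smooth_at x f -> smooth_at x g ->
  differentiable_at x (lieD W (fwd (at_ x))) ->
  lieD W (lieD W (fun y => f y * g y)) x =
    f x * lieD W (lieD W g) x + g x * lieD W (lieD W f) x +
    2 * (lieD W f x * lieD W g x).
Proof.
move=> sf sg dW.
have df := smooth_differentiable_at has_coords_scalar sf.
have dg := smooth_differentiable_at has_coords_scalar sg.
have dWf := differentiable_lieD sf dW; have dWg := differentiable_lieD sg dW.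
rewrite [LHS]/lieD (@dfun_near_eq _ _
    (fun y => f y * lieD W g y + g y * lieD W f y)); last first.
  apply: filterS2 (near_smooth_differentiable has_coords_scalar sf)
    (near_smooth_differentiable has_coords_scalar sg) => y dfy dgy.
  by rewrite /lieD dfunM.
rewrite dfunD ?dfunM//; try exact: differentiable_atM.
rewrite -!/(lieD _ _ _).
move: (f x) (g x) (lieD W f x) (lieD W g x) (lieD W (lieD W f) x)
  (lieD W (lieD W g) x) => a b c d p q; ring.
Qed.

(** Polarization leaves half the sum of the products [lieD (X j) f x * lieD (X j) g x]. Uniqueness
    holds because coordinate forms, taken as [f], separate vectors. *)
Lemma symbol_diffusion_generator (m : nat) (X : 'I_m -> vfield M) (A : vfield M)
    (x : M) (beta : {linear E -> R}) :
  (forall j, differentiable_at x (lieD (X j) (fwd (at_ x)))) -> continuous beta ->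
  symbol (diffusion_generator X A) x beta =
    \sum_(j < m) (2^-1 * beta (X j x)) *: X j x.
Proof.
(* Continuous linear forms composed with the chart are smooth functions with prescribed differential
   at [x]: one of them realizes [beta], the others test the value of the symbol. *)
move=> dX betac; have smooth_lin (l : {linear E -> R}) : continuous l ->
    smooth_at x (l \o fwd (at_ x)) /\
    forall v, dfun (l \o fwd (at_ x)) x v = l v.
  move=> lc.
  have oU : open (fwd (at_ x) @` (dom (at_ x) `&` dom (at_ x))).
    exact: atlas_open.
  have Ux : (fwd (at_ x) @` (dom (at_ x) `&` dom (at_ x))) (fwd (at_ x) x).
    by exists x => //; split; exact: domP.
  split=> [|v].
    exists (fwd (at_ x) @` (dom (at_ x) `&` dom (at_ x))); first by split.
    apply: (smooth_on_linear oU lc) => _ [y [iy _] <-] /=.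
    by rewrite bwdK.
  rewrite -(linear_derive (fwd (at_ x) x) v lc); apply: near_eq_derive.
  by apply: filterS (near_chart (domP x) (domP x)) => y [_ _] /= ->.
have half_symbol (a b p q r s t : R) :
    2^-1 * (2^-1 * (a * p + b * q + 2 * r) + (a * t + b * s)) -
    2^-1 * ((2^-1 * q + s) * b) - 2^-1 * (a * (2^-1 * p + t)) = 2^-1 * r.
  by field.
have symE (f g : M -> R) : smooth_at x f -> smooth_at x g ->
    (forall v, dfun g x v = beta v) ->
    2^-1 * diffusion_generator X A (fun y => f y * g y) x
      - 2^-1 * (diffusion_generator X A f x * g x)
      - 2^-1 * (f x * diffusion_generator X A g x) =
    dfun f x (\sum_(j < m) (2^-1 * beta (X j x)) *: X j x).
  move=> sf sg gbeta.
  have df := smooth_differentiable_at has_coords_scalar sf.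
  have dg := smooth_differentiable_at has_coords_scalar sg.
  have second_order : \sum_(j < m) lieD (X j) (lieD (X j) (fun y => f y * g y)) x =
      f x * (\sum_(j < m) lieD (X j) (lieD (X j) g) x) +
      g x * (\sum_(j < m) lieD (X j) (lieD (X j) f) x) +
      2 * (\sum_(j < m) lieD (X j) f x * lieD (X j) g x).
    rewrite !mulr_sumr -big_split -big_split; apply: eq_bigr => j _.
    exact: lieD_lieD_mul sf sg (dX j).
  have first_order : lieD A (fun y => f y * g y) x =
    f x * lieD A g x + g x * lieD A f x by exact: dfunM.
  have genE : diffusion_generator X A (fun y => f y * g y) x = _ :=
    congr2 (fun a b => 2^-1 * a + b) second_order first_order.
  rewrite genE.
  pose lf : {linear E -> R} :=
    HB.pack (dfun f x) (GRing.isLinear.Build _ _ _ _ _ (dfun_linear df)).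
  have -> : dfun f x (\sum_(j < m) (2^-1 * beta (X j x)) *: X j x) =
      2^-1 * \sum_(j < m) lieD (X j) f x * lieD (X j) g x.
    rewrite -[LHS]/(lf _) linear_sum mulr_sumr; apply: eq_bigr => j _.
    rewrite linearZ -gbeta.
    rewrite -[LHS]/(2^-1 * lieD (X j) g x * lieD (X j) f x).
    by rewrite -mulrA [lieD _ g x * _]mulrC.
  exact: half_symbol.
apply: xget_unique => [f g sf sg gbeta|z zP]; first by rewrite symE.
have [I [e [c [cc ce]]]] := coordsE.
rewrite [LHS]ce [RHS]ce; apply: eq_bigr => k _; congr (_ *: _).
have [sc ck] := smooth_lin _ (cc k); have [sb bk] := smooth_lin _ betac.
by rewrite -[LHS]ck -[RHS]ck (zP _ _ sc sb bk) symE.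
Qed.

End Atlas.

(** * Flows and the atlas of the frame bundle *)

Section Pairs.
Context {R : realType}.
Implicit Types E F : normedModType R.

Lemma differentiable_id E (x : E) : differentiable idfun x.
Proof. exact: (@ex_diff _ _ _ _ _ _ _ (is_diff_id x)). Qed.

Lemma is_diff_fst E F (p : (E * F)%type) : is_diff p (@fst E F) fst.
Proof.
have lin : linear (@fst E F) by [].
pose l : {linear (E * F)%type -> E} :=
  HB.pack (@fst E F) (GRing.isLinear.Build _ _ _ _ _ lin).
have lc : continuous l by move=> q; exact: cvg_fst.
split; first by apply: (@linear_differentiable _ _ _ l).
exact: (@diff_lin _ _ _ l).
Qed.

Lemma is_diff_snd E F (p : (E * F)%type) : is_diff p (@snd E F) snd.
Proof.
have lin : linear (@snd E F) by [].
pose l : {linear (E * F)%type -> F} :=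
  HB.pack (@snd E F) (GRing.isLinear.Build _ _ _ _ _ lin).
have lc : continuous l by move=> q; exact: cvg_snd.
split; first by apply: (@linear_differentiable _ _ _ l).
exact: (@diff_lin _ _ _ l).
Qed.

Lemma differentiable_fst E F (p : (E * F)%type) : differentiable (@fst E F) p.
Proof. by have [] := is_diff_fst p. Qed.

Lemma differentiable_snd E F (p : (E * F)%type) : differentiable (@snd E F) p.
Proof. by have [] := is_diff_snd p. Qed.

Lemma is_derive_fst E F (p h : (E * F)%type) : is_derive p h (@fst E F) h.1.
Proof. by have [df dE] := is_diff_fst p; apply: diff_derive; rewrite ?dE. Qed.

Lemma is_derive_snd E F (p h : (E * F)%type) : is_derive p h (@snd E F) h.2.
Proof. by have [df dE] := is_diff_snd p; apply: diff_derive; rewrite ?dE. Qed.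

End Pairs.

(** * Vector fields as velocities of their flows *)

Section Flow.
Context {R : realType} {E : normedModType R}.
Variable M : charted E.
Hypothesis atM : differentiable_atlas M.
Hypothesis coordsE : has_coords E.
Variables (W : vfield M) (D : R -> set M) (phi : R -> M -> M).
Hypothesis flowW : local_flow W D phi.

Definition flow_in_chart (x : M) (p : R * E) : E :=
  fwd (at_ x) (phi p.1 (bwd (at_ x) p.2)).

Lemma flow0 x : phi 0 x = x.
Proof. by have [+ _ _ _] := flowW => /(_ x)[]. Qed.

Lemma flow_smooth (x : M) : exists U : set (R * E),
  [/\ open_nbhs (0, fwd (at_ x) x) U,
      forall p, U p -> dom (at_ x) (phi p.1 (bwd (at_ x) p.2)) &
      smooth_on U (flow_in_chart x)].
Proof.
have [D0 _ sphi _] := flowW; have [D0x _] := D0 x.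
have [U [oU domU smU]] := sphi 0 x D0x.
move: domU smU; rewrite flow0 => domU smU; exists U; split=> // p /domU[] //.
Qed.

Lemma near_flow_dom (x : M) : \forall s \near (0 : R), dom (at_ x) (phi s x).
Proof.
have [U [[oU U0] domU _]] := flow_smooth x.
have nU : nbhs ((0 : R), fwd (at_ x) x) U by exact: open_nbhs_nbhs.
have sc : (fun s : R => (s, fwd (at_ x) x)) @ (0 : R) --> ((0 : R), fwd (at_ x) x).
  exact: (differentiable_continuous (differentiable_pair (differentiable_id _)
    (differentiable_cst _ _))).
have near_s : \forall s \near (0 : R), U (s, fwd (at_ x) x) := sc _ nU.
apply: filterS near_s => s /domU /=.
by rewrite (atlas_fwdK atM)//; exact: atlas_dom.
Qed.

Lemma flow_vfield (x : M) :
  is_derive (0 : R) 1 (fun s => fwd (at_ x) (phi s x)) (W x).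
Proof.
have [D0 _ _ dphi] := flowW; have [D0x _] := D0 x.
by have := dphi 0 x D0x; rewrite flow0.
Qed.

Lemma lieD_flow (i : idx M) (x : M) : dom i x ->
  is_derive (0 : R) 1 (fun s => fwd i (phi s x)) (lieD W (fwd i) x).
Proof.
move=> ix; have jx := atlas_dom atM x.
have dt : differentiable (fwd i \o bwd (at_ x)) (fwd (at_ x) (phi 0 x)).
  by rewrite flow0; exact: transition_differentiable.
have := is_derive_comp (flow_vfield x) dt; rewrite flow0.
rewrite /lieD dfun_fwd//; apply: near_eq_is_derive.
apply: filterS (near_flow_dom x) => s js /=.
by rewrite (atlas_fwdK atM).
Qed.

(* The local expression of [W] is the time derivative of its flow, hence is as
   smooth as the flow: [local_flow] does not assume that [W] is smooth. *)
Lemma lieD_flow_in_chart (x : M) (U : set (R * E)) (y : E) : open U ->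
  smooth_on U (flow_in_chart x) -> U (0, y) -> dom (at_ x) (bwd (at_ x) y) ->
  lieD W (fwd (at_ x)) (bwd (at_ x) y) = 'D_(1, 0) (flow_in_chart x) (0, y).
Proof.
move=> oU sU Uy iy; have [_ <-] := lieD_flow iy.
have U0y : U ((0, y) + (0 : R) *: (1, 0)) by rewrite scale0r addr0.
have dv : derivable (flow_in_chart x) ((0, y) + (0 : R) *: (1, 0)) (1, 0).
  exact: smooth_on_derivable sU U0y.
have := is_derive_line dv.
rewrite scale0r addr0 => -[_ <-].
rewrite (_ : (fun t : R => _) = (fun s => fwd (at_ x) (phi s (bwd (at_ x) y))))//.
apply/funext => t; rewrite /flow_in_chart/=.
by rewrite scaler0 addr0 add0r [_ *: _]mulr1.
Qed.

Lemma near_flow_slice (x : M) (U : set (R * E)) :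
  open_nbhs (0, fwd (at_ x) x) U -> \forall y \near fwd (at_ x) x, U (0, y).
Proof.
move=> [oU U0].
have nU : nbhs ((0 : R), fwd (at_ x) x) U by exact: open_nbhs_nbhs.
have sc : (fun y => ((0 : R), y)) @ fwd (at_ x) x --> ((0 : R), fwd (at_ x) x).
  exact: (differentiable_continuous (differentiable_pair
    (differentiable_cst _ _) (differentiable_id _))).
exact: (sc _ nU).
Qed.

Lemma near_lieD_flow_in_chart (x : M) (U : set (R * E)) :
  open_nbhs (0, fwd (at_ x) x) U -> smooth_on U (flow_in_chart x) ->
  \forall y \near fwd (at_ x) x,
    'D_(1, 0) (flow_in_chart x) (0, y) =
    (lieD W (fwd (at_ x)) \o bwd (at_ x)) y.
Proof.
move=> oU smU; have [oU' _] := oU.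
apply: filterS2 (near_flow_slice oU)
  (near_chart atM (atlas_dom atM x) (atlas_dom atM x)) => y Uy [iy _ _].
by rewrite /= (lieD_flow_in_chart oU' smU).
Qed.

Lemma flow_differentiable (x : M) : differentiable_at x (lieD W (fwd (at_ x))).
Proof.
have [U [oU _ smU]] := flow_smooth x; have [oU' U0] := oU.
apply: near_differentiable (near_lieD_flow_in_chart oU smU) _.
apply: (@differentiable_comp _ _ _ _ (fun y => ((0 : R), y))
  ('D_(1, 0) (flow_in_chart x))).
  by apply: differentiable_pair; [exact: differentiable_cst|exact: differentiable_id].
apply: smooth_on_differentiable (smooth_on_derive _ smU) => //.
by apply: has_coords_prod => //; exact: has_coords_scalar.
Qed.

End Flow.

Lemma unitmx_open {R : realType} n : open [set a : 'M[R]_n | a \in unitmx].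
Proof.
by rewrite openE => a au; apply: (@near_unitmx _ _ _ idfun).
Qed.

Lemma linear_derive_at {R : realType} (E F : normedModType R) (f : E -> F) (x : E) :
  differentiable f x -> linear (fun v => 'D_v f x).
Proof. by move=> df a u v; rewrite !deriveE// linearP. Qed.

(** * The induced atlas of the frame bundle *)

Section FrameBundleAtlas.
Context {R : realType} {n : nat}.
Variable M : charted 'cV[R]_n.
Hypothesis smM : smooth_manifold M.
Local Notation E := 'cV[R]_n.
Local Notation coordsE := (has_coords_mx n 1).

Lemma manifold_atlas : differentiable_atlas M.
Proof.
split; [exact: dom_at|exact: fwdK|exact: open_overlap|].
move=> i j y yij; apply: smooth_on_differentiable (smooth_transition smM i j) => //;
  try exact: has_coords_mx.
exact: open_overlap.
Qed.
Local Notation atM := manifold_atlas.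
Local Notation domP := (atlas_dom atM).
Local Notation bwdK := (atlas_fwdK atM).

Lemma frame_mx_unit (u : GL M) : frame_mx u \in unitmx.
Proof. exact: (valP u.2). Qed.

Lemma mk_frame_val (u : GL M) : mk_frame (GLproj u) (frame_mx u) = u.
Proof. by case: u => x a; rewrite /mk_frame /frame_mx /GLproj /= valKd. Qed.

Lemma derive_transition (i j : idx M) (x : M) (v : E) : dom i x -> dom j x ->
  'D_v (fwd j \o bwd i) (fwd i x) = 'd (fwd j \o bwd i) (fwd i x) v.
Proof. by move=> ix jx; rewrite deriveE//; exact: (transition_differentiable atM). Qed.

Lemma derive_transition_comp (i j : idx M) (x : M) (v : E) : dom i x -> dom j x ->
  dfun (fwd j) x ('D_v (fwd (at_ x) \o bwd i) (fwd i x)) =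
  'D_v (fwd j \o bwd i) (fwd i x).
Proof.
move=> ix jx; have kx := domP x; rewrite !derive_transition// (dfun_fwd atM)//.
have [_ dE] := change_chart atM kx ix (transition_differentiable atM kx jx).
exact: esym (dE v).
Qed.

Lemma dfun_fwd_unit (i : idx M) (x : M) : dom i x ->
  comp_cols (dfun (fwd i) x) 1%:M \in unitmx.
Proof.
move=> ix.
apply: (@comp_cols_unit _ _ ('d (fwd (at_ x) \o bwd i) (fwd i x))).
- exact: linearP.
- by apply: dfun_linear; apply: (transition_differentiable atM) => //; exact: domP.
- move=> v; rewrite (dfun_fwd atM)//; apply: (transition_cancel atM) => //.
  exact: domP.
Qed.

Lemma bwd_dfun_fwd (i : idx M) (x : M) (v : E) : dom i x ->
  'D_(dfun (fwd i) x v) (fwd (at_ x) \o bwd i) (fwd i x) = v.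
Proof.
move=> ix; have jx := domP x.
by rewrite derive_transition// (dfun_fwd atM)// (transition_cancel atM).
Qed.

Lemma derive_fwd_unit (i : idx M) (x : M) : dom i x ->
  comp_cols (fun v => 'D_v (fwd (at_ x) \o bwd i) (fwd i x)) 1%:M \in unitmx.
Proof.
move=> ix; have jx := domP x.
apply: (@comp_cols_unit _ _ (dfun (fwd i) x)).
- by apply: dfun_linear; apply: (transition_differentiable atM).
- by move=> a v w; rewrite !derive_transition// linearP.
- by move=> v; rewrite derive_transition// (dfun_fwd atM)// (transition_cancel atM).
Qed.

Lemma GL_fwdK (i : idx M) (u : GL M) : dom i (GLproj u) ->
  @bwd _ _ (GL M) i (@fwd _ _ (GL M) i u) = u.
Proof.
move=> iu; rewrite /= bwdK//; rewrite comp_cols_comp comp_cols_id.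
  exact: mk_frame_val.
by move=> v; exact: bwd_dfun_fwd.
Qed.

(** [mk_frame] replaces a singular matrix by the identity, so the inverse chart has its intended
    value only once this is known. *)
Lemma GL_bwd_unit (i : idx M) (y : E) (b : 'M[R]_n) : dom i (bwd i y) ->
  fwd i (bwd i y) = y -> b \in unitmx ->
  comp_cols (fun v => 'D_v (fwd (at_ (bwd i y)) \o bwd i) y) b \in unitmx.
Proof.
move=> iy yK bu; have := derive_fwd_unit iy; rewrite yK => du.
rewrite comp_colsE; first by rewrite unitmx_mul bu andbT.
apply: linear_derive_at; have := transition_differentiable atM iy (domP _).
by rewrite yK.
Qed.

(** The preferred chart at the base point enters through both [bwd] and [fwd] of GL(M) and cancels
    by the chain rule. *)
Lemma GL_transition (i j : idx M) (y : E) (b : 'M[R]_n) :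
  dom i (bwd i y) -> dom j (bwd i y) -> fwd i (bwd i y) = y -> b \in unitmx ->
  @fwd _ _ (GL M) j (@bwd _ _ (GL M) i (y, b)) =
  ((fwd j \o bwd i) y, comp_cols (fun v => 'D_v (fwd j \o bwd i) y) b).
Proof.
move=> iy jy yK bu; rewrite /= insubdK; last exact: GL_bwd_unit.
have LE : dfun (fwd j) (bwd i y) \o
    (fun v => 'D_v (fwd (at_ (bwd i y)) \o bwd i) y) =
    (fun v => 'D_v (fwd j \o bwd i) y).
  apply/funext => v; rewrite -[LHS]/(dfun _ _ ('D_v _ _)).
  by have := derive_transition_comp v iy jy; rewrite yK.
by rewrite comp_cols_comp LE.
Qed.

Lemma near_GL_chart (i j : idx M) (u : GL M) : dom i (GLproj u) -> dom j (GLproj u) ->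
  \forall p \near @fwd _ _ (GL M) i u,
    [/\ dom i (bwd i p.1), dom j (bwd i p.1), fwd i (bwd i p.1) = p.1 &
        p.2 \in unitmx].
Proof.
move=> iu ju; set p0 := @fwd _ _ (GL M) i u.
have n1 : \forall p \near p0, [/\ dom i (bwd i p.1), dom j (bwd i p.1) &
    fwd i (bwd i p.1) = p.1].
  have c1 : p.1 @[p --> p0] --> p0.1 by exact: cvg_fst.
  exact: (c1 _ (near_chart atM iu ju)).
have n2 : \forall p \near p0, p.2 \in unitmx.
  have c2 : p.2 @[p --> p0] --> p0.2 by exact: cvg_snd.
  have u2 : nbhs p0.2 [set a : 'M[R]_n | a \in unitmx].
    apply: open_nbhs_nbhs; split; first exact: unitmx_open.
    rewrite /= comp_colsE; last first.
      by apply: dfun_linear; apply: (transition_differentiable atM) => //; exact: domP.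
    by rewrite unitmx_mul dfun_fwd_unit//; exact: frame_mx_unit.
  exact: (c2 _ u2).
by apply: filterS2 n1 n2 => p [? ? ?] ?; split.
Qed.

Lemma GL_transition_differentiable (i j : idx M) (u : GL M) :
  dom i (GLproj u) -> dom j (GLproj u) ->
  differentiable (@fwd _ _ (GL M) j \o @bwd _ _ (GL M) i) (@fwd _ _ (GL M) i u).
Proof.
move=> iu ju.
pose g (p : (E * 'M[R]_n)%type) : (E * 'M[R]_n)%type := (((@fwd _ _ M j) \o bwd i) p.1,
    comp_cols (fun v => 'D_v (fwd j \o bwd i) p.1) p.2).
have ng : \forall p \near @fwd _ _ (GL M) i u,
    g p = (@fwd _ _ (GL M) j \o @bwd _ _ (GL M) i) p.
  apply: filterS (near_GL_chart iu ju) => -[y b] [iy jy yK bu].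
  exact: esym (GL_transition iy jy yK bu).
apply: (near_differentiable ng); apply: differentiable_pair.
  apply: (@differentiable_comp _ _ _ _ fst (fwd j \o bwd i)).
    exact: differentiable_fst.
  exact: (transition_differentiable atM).
apply: differentiable_mx => k l; under eq_fun do rewrite mxE.
apply: differentiable_entry.
apply: (@differentiable_derive_along R (E * 'M[R]_n)%type E E _ (fwd j \o bwd i)
  fst (fun p => col l p.2) _ coordsE coordsE (open_overlap smM i j)).
- by exists (GLproj u).
- exact: smooth_transition.
- exact: differentiable_fst.
- apply: differentiable_mx => r s; under eq_fun do rewrite mxE.
  by apply: differentiable_entry; exact: differentiable_snd.
Qed.

Lemma GL_atlas : differentiable_atlas (GL M).
Proof.
(* Overlaps of the induced charts are open because those of M are and invertibility is an open
   condition on the matrix. *)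
have sep (i j : idx M) (u : GL M) : dom i (GLproj u) -> dom j (GLproj u) ->
    \forall p \near @fwd _ _ (GL M) i u,
      (@fwd _ _ (GL M) i @` (@dom _ _ (GL M) i `&` @dom _ _ (GL M) j)) p.
  move=> iu ju; apply: filterS (near_GL_chart iu ju) => -[y b] /= [iy jy yK bu].
  exists (@bwd _ _ (GL M) i (y, b)); first by [].
  apply: etrans (GL_transition iy iy yK bu) _; congr pair; first exact: yK.
  by apply: comp_cols_id => v; rewrite -[y in LHS]yK (derive_transition_id atM).
split.
- by move=> u; exact: domP.
- by move=> i u iu; exact: GL_fwdK.
- move=> i j; rewrite openE => _ [u [iu ju] <-]; exact: sep.
- by move=> i j _ [u [iu ju] <-]; exact: (GL_transition_differentiable iu ju).
Qed.

End FrameBundleAtlas.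

(** * Natural lifts of vector fields *)

Section NaturalLift.
Context {R : realType}.

Lemma derive_slice (E F G : normedModType R) (f : E * F -> G) (x : E) (y v : F) :
  'D_v (fun y => f (x, y)) y = 'D_(0, v) f (x, y).
Proof.
rewrite /derive (_ : (fun h : R => h^-1 *: ((f \o shift (x, y)) (h *: (0, v)) -
  f (x, y))) = (fun h => h^-1 *: (((fun y => f (x, y)) \o shift y) (h *: v) -
  f (x, y))))//.
apply/funext => h /=.
by rewrite -[h *: (0, v) + (x, y)]/(h *: 0 + x, h *: v + y) scaler0 add0r.
Qed.

Lemma is_derive_slice1 (E F : normedModType R) (f : R * E -> F) (y : E) (s : R) :
  derivable f (s, y) (1, 0) ->
  is_derive s 1 (fun t : R => f (t, y)) ('D_(1, 0) f (s, y)).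
Proof.
move=> df; have shiftE t : (0, y) + t *: ((1, 0) : R * E) = (t, y).
  rewrite -[LHS]/(0 + t *: 1, y + t *: 0) scaler0 addr0 add0r.
  by rewrite [t *: 1]mulr1.
have := @is_derive_line _ _ _ f (0, y) (1, 0) s; rewrite shiftE => /(_ df).
by under [X in is_derive _ _ X _]eq_fun do rewrite shiftE.
Qed.

Lemma is_derive_pair (E F : normedModType R) (f : R -> E) (g : R -> F) (t : R)
    (df : E) (dg : F) : is_derive t 1 f df -> is_derive t 1 g dg ->
  is_derive t 1 (fun s => (f s, g s)) (df, dg).
Proof.
move=> [/derivable1_diffP ft <-] [/derivable1_diffP gt <-].
apply: diff_derive; first exact: differentiable_pair.
by rewrite diff_pair//= !deriveE.
Qed.

Variables (n : nat) (M : charted 'cV[R]_n).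
Hypothesis smM : smooth_manifold M.
Local Notation E := 'cV[R]_n.
Local Notation coordsE := (has_coords_mx n 1).
Local Notation atM := (manifold_atlas smM).
Local Notation domP := (atlas_dom atM).
Local Notation bwdK := (atlas_fwdK atM).
Variables (W : vfield M) (D : R -> set M) (phi : R -> M -> M).
Hypothesis flowW : local_flow W D phi.

(** The preferred chart of [phi s x], hidden in [frame_push], cancels and leaves the spatial
    derivative of the flow in the chart at [x]. Invertibility is assumed so that [mk_frame] keeps
    the matrix. *)
Lemma frame_push_in_chart (U : set (R * E)) (u : GL M) (s : R) :
  open U -> smooth_on U (flow_in_chart phi (GLproj u)) ->
  (forall p, U p -> dom (at_ (GLproj u)) (phi p.1 (bwd (at_ (GLproj u)) p.2))) ->
  U (s, fwd (at_ (GLproj u)) (GLproj u)) ->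
  comp_cols (fun v => 'D_(0, v) (flow_in_chart phi (GLproj u))
    (s, fwd (at_ (GLproj u)) (GLproj u))) (frame_mx u) \in unitmx ->
  @fwd _ _ (GL M) (at_ u) (frame_push (phi s) u) =
  (fwd (at_ (GLproj u)) (phi s (GLproj u)),
   comp_cols (fun v => 'D_(0, v) (flow_in_chart phi (GLproj u))
     (s, fwd (at_ (GLproj u)) (GLproj u))) (frame_mx u)).
Proof.
set x := GLproj u; set i := at_ x; set y := fwd i x; set Psi := flow_in_chart phi x.
move=> oU smU domU Us unitD.
have ix : dom i x by exact: domP.
have z_dom : dom i (phi s x) by have /= := domU _ Us; rewrite bwdK.
have k_dom : dom (at_ (phi s x)) (phi s x) by exact: domP.
have dPsi : differentiable (fun y => Psi (s, y)) y.
  apply: (@differentiable_comp _ _ _ _ (fun y => (s, y)) Psi).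
    by apply: differentiable_pair; [exact: differentiable_cst|exact: differentiable_id].
  apply: smooth_on_differentiable smU => //; last exact: has_coords_mx.
  by apply: has_coords_prod; [exact: has_coords_scalar|exact: has_coords_mx].
have PsiE : Psi (s, y) = fwd i (phi s x) by rewrite /Psi /flow_in_chart /= bwdK.
have TE : dfun (fwd i) (phi s x) \o tangent_map (phi s) x =
    (fun v => 'D_(0, v) Psi (s, y)).
  apply/funext => v; rewrite -derive_slice deriveE//.
  rewrite -[LHS]/(dfun _ _ (tangent_map _ _ _)).
  have dk : differentiable (fwd (at_ (phi s x)) \o bwd i) (Psi (s, y)).
    by rewrite PsiE; exact: (transition_differentiable atM).
  rewrite (dfun_fwd atM)// -[RHS](transition_cancel atM _ z_dom k_dom); congr ('d _ _ _).
  rewrite /tangent_map /dfun (@near_eq_derive _ _ _ _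
      ((fwd (at_ (phi s x)) \o bwd i) \o (fun y => Psi (s, y)))); last first.
    have nU : nbhs (s, y) U by exact: open_nbhs_nbhs.
    have c : (s, z) @[z --> y] --> (s, y).
      exact: (differentiable_continuous (differentiable_pair
        (differentiable_cst _ _) (differentiable_id _))).
    have near_U : \forall z \near y, U (s, z) := c _ nU.
    apply: filterS near_U => z Uz /=.
    by rewrite /Psi /flow_in_chart/= bwdK//; exact: (domU _ Uz).
  have dC : 'D_v ((fwd (at_ (phi s x)) \o bwd i) \o (fun y => Psi (s, y))) y =
    'd (fwd (at_ (phi s x)) \o bwd i) (Psi (s, y)) ('d (fun y => Psi (s, y)) y v) :=
    derive_comp v dPsi dk.
  by rewrite PsiE in dC; exact: dC.
rewrite /frame_push /=.
(* The tangent map composed with the frame is a right factor of the invertible matrix in [unitD]. *)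
have key : comp_cols (tangent_map (phi s) x) (frame_mx u) \in unitmx.
  move: unitD; rewrite -TE -comp_cols_comp comp_colsE.
    by rewrite unitmx_mul => /andP[].
  by apply: dfun_linear; apply: (transition_differentiable atM).
by rewrite insubdK// comp_cols_comp TE.
Qed.

(* The frame component is the derivative in [s] of the spatial derivative of the
   flow; exchanging the two gives the spatial derivative of [W]. *)
Lemma frame_push_velocity (u : GL M) :
  is_derive (0 : R) 1 (fun s => @fwd _ _ (GL M) (at_ u) (frame_push (phi s) u))
    (W (GLproj u), comp_cols (fun v =>
      'D_v (lieD W (fwd (at_ (GLproj u))) \o bwd (at_ (GLproj u)))
        (fwd (at_ (GLproj u)) (GLproj u))) (frame_mx u)).
Proof.
set x := GLproj u; set i := at_ x; set y := fwd i x; set Psi := flow_in_chart phi x.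
have [U [oU domU smU]] := flow_smooth flowW x; have [oU' U0] := oU.
have coordsRE : has_coords (R * E)%type.
  by apply: has_coords_prod; [exact: has_coords_scalar|exact: has_coords_mx].
pose N (s : R) := comp_cols (fun v => 'D_(0, v) Psi (s, y)) (frame_mx u).
have dD v : is_derive (0 : R) 1 (fun s : R => 'D_(0, v) Psi (s, y))
    ('D_v (lieD W (fwd i) \o bwd i) y).
  have <- : 'D_(1, 0) ('D_(0, v) Psi) (0, y) = 'D_v (lieD W (fwd i) \o bwd i) y.
    rewrite (smooth_on_derive_comm _ _ coordsRE coordsE oU' U0 smU) -derive_slice.
    exact: near_eq_derive (near_lieD_flow_in_chart atM flowW oU smU).
  apply: is_derive_slice1; exact: smooth_on_derivable (smooth_on_derive _ smU) U0.
have dN : is_derive (0 : R) 1 N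
    (comp_cols (fun v => 'D_v (lieD W (fwd i) \o bwd i) y) (frame_mx u)).
  apply: is_derive_mx => k l; rewrite !mxE.
  under [X in is_derive _ _ X _]eq_fun do rewrite mxE.
  exact: is_derive_entry (dD (col l (frame_mx u))).
have N0 : N 0 = frame_mx u.
  apply: comp_cols_id => v; rewrite -derive_slice.
  rewrite -[RHS](derive_transition_id atM v (domP x)).
  apply: near_eq_derive; near=> z.
  by rewrite /Psi /flow_in_chart /= (flow0 flowW).
have dpair := is_derive_pair (flow_vfield flowW x) dN.
apply: near_eq_is_derive dpair.
(* Invertibility at time 0, where [N] is the frame itself, persists for small times, as
   [frame_push_in_chart] requires. *)
have nN : \forall s \near (0 : R), N s \in unitmx.
  apply: near_unitmx; last by rewrite N0; exact: frame_mx_unit.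
  by apply/derivable1_diffP; have [] := dN.
have nU : \forall s \near (0 : R), U (s, y).
  have nU0 : nbhs ((0 : R), y) U by exact: open_nbhs_nbhs.
  have c : (s, y) @[s --> (0 : R)] --> ((0 : R), y).
    exact: (differentiable_continuous (differentiable_pair
      (differentiable_id _) (differentiable_cst _ _))).
  exact: (c _ nU0).
apply: filterS2 nN nU => s Ns Us.
by rewrite (frame_push_in_chart oU').
Unshelve. all: by end_near. Qed.

End NaturalLift.

Lemma natural_lift_differentiable {R : realType} (n : nat) (M : charted 'cV[R]_n)
    (W : vfield M) (Wt : vfield (GL M)) (u : GL M) : smooth_manifold M ->
  natural_lift W Wt -> differentiable_at u (lieD Wt (@fwd _ _ (GL M) (at_ u))).
Proof.
move=> smM [D [phi [_ flowWt]]].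
apply: (flow_differentiable (GL_atlas smM) _ flowWt).
by apply: has_coords_prod; exact: has_coords_mx.
Qed.

(** Both sides are the velocity at time 0 of the same curve of frames, because the flow of [Wt] is
    the [frame_push] of the flow of [W]. *)
Lemma natural_liftE {R : realType} (n : nat) (M : charted 'cV[R]_n)
    (W : vfield M) (Wt : vfield (GL M)) (u : GL M) : smooth_manifold M ->
  natural_lift W Wt -> Wt u = (W (GLproj u), comp_cols (fun v =>
    'D_v (lieD W (fwd (at_ (GLproj u))) \o bwd (at_ (GLproj u)))
      (fwd (at_ (GLproj u)) (GLproj u))) (frame_mx u)).
Proof.
move=> smM [D [phi [flowW flowWt]]].
have [_ <-] := frame_push_velocity smM flowW u.
by have [_ <-] := flow_vfield flowWt u.
Qed.

(** * The pseudo-inverse of X and the induced semi-connection *)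

Section DotProduct.
Context {R : realType} (n m : nat).

Lemma dotE (e f : 'cV[R]_m) : dot e f = (e^T *m f) 0 0.
Proof. by rewrite mxE; apply: eq_bigr => j _; rewrite mxE. Qed.

Lemma dot_sym (e f : 'cV[R]_m) : dot e f = dot f e.
Proof. by apply: eq_bigr => j _; rewrite mulrC. Qed.

Lemma dotBl (a b c : 'cV[R]_m) : dot (a - b) c = dot a c - dot b c.
Proof. by rewrite !dotE linearB/= mulmxBl !mxE. Qed.

Lemma dotBr (a b c : 'cV[R]_m) : dot a (b - c) = dot a b - dot a c.
Proof. by rewrite !dotE mulmxBr !mxE. Qed.

Lemma dot_eq0 (e : 'cV[R]_m) : dot e e = 0 -> e = 0.
Proof.
move=> /eqP; rewrite psumr_eq0 => [/allP e0|j _]; last by rewrite -expr2 sqr_ge0.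
apply/colP => j; rewrite mxE; apply/eqP.
by have := e0 j (mem_index_enum _); rewrite -expr2 sqrf_eq0.
Qed.

(** If [u P P^T = 0] then [|u P|^2 = 0], so by positivity over the reals [P P^T] and [P] have the
    same row kernel. *)
Lemma mxrank_gram (P : 'M[R]_(n, m)) : \rank (P *m P^T) = \rank P.
Proof.
have kerP : (kermx (P *m P^T) <= kermx P)%MS.
  apply/rV_subP => u /sub_kermxP uPP; apply/sub_kermxP/trmx_inj.
  rewrite trmx0; apply: dot_eq0; rewrite dotE trmxK trmx_mul.
  by rewrite -!mulmxA (mulmxA P) (mulmxA u) uPP mul0mx mxE.
apply/eqP; rewrite eqn_leq mxrankM_maxl/=.
by have := mxrankS kerP; rewrite !mxrank_ker leq_sub2lE ?rank_leq_row.
Qed.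

(** Every value of [P] is attained on the range of [P^T], which is orthogonal to the kernel: this
    yields the minimal-norm preimage without an orthogonal projection. *)
Lemma gram_image (P : 'M[R]_(n, m)) (e : 'cV[R]_m) :
  exists z : 'cV[R]_n, P *m (P^T *m z) = P *m e.
Proof.
have PP : (P^T <= P *m P^T)%MS.
  by have [_ <-] := mxrank_leqif_sup (submxMl P P^T);
    rewrite mxrank_tr mxrank_gram.
have /submxP[z ez] : (e^T *m P^T <= P *m P^T)%MS.
  exact: submx_trans (submxMl _ _) PP.
exists z^T; apply: trmx_inj.
by rewrite !trmx_mul !trmxK ez mulmxA.
Qed.

End DotProduct.

Section PseudoInverse.
Context {R : realType} (n m : nat) (M : charted 'cV[R]_n).
Variable X : 'I_m -> vfield M.

Definition Xmatrix (x : M) : 'M[R]_(n, m) := \matrix_(i, j) X j x i 0.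

Lemma XmapE (x : M) (e : 'cV[R]_m) : Xmap X x e = Xmatrix x *m e.
Proof.
apply/colP => i; rewrite summxE mxE; apply: eq_bigr => j _.
by rewrite !mxE mulrC.
Qed.

Lemma perp_ker_trmx (x : M) (z : 'cV[R]_n) : perp_ker X x ((Xmatrix x)^T *m z).
Proof.
move=> k; rewrite XmapE => Xk0.
by rewrite dotE trmx_mul trmxK -mulmxA Xk0 mulmx0 mxE.
Qed.

Lemma perp_ker_uniq (x : M) (e f : 'cV[R]_m) : perp_ker X x e -> perp_ker X x f ->
  Xmap X x e = Xmap X x f -> e = f.
Proof.
move=> pe pf ef; apply/subr0_eq/dot_eq0.
have Xef : Xmap X x (e - f) = 0.
  by move: ef; rewrite !XmapE mulmxBr => ->; rewrite subrr.
by rewrite dotBl pe// pf// subrr.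
Qed.

Lemma mem_distr (x : M) (w : 'cV[R]_n) :
  w \in distr X x -> exists e, w = Xmatrix x *m e.
Proof.
rewrite /distr => ws.
have := coord_span (X := [tuple X j x | j < m]) ws.
move=> ->; exists (\col_j coord [tuple X j x | j < m] j w).
rewrite -XmapE; apply: eq_bigr => j _.
by rewrite (nth_map j) ?size_enum_ord// nth_ord_enum mxE.
Qed.

Lemma Xmap_distr (x : M) (e : 'cV[R]_m) : Xmap X x e \in distr X x.
Proof.
apply: rpred_sum => j _; apply: rpredZ; apply: memv_span.
by apply/mapP; exists j => //; rewrite mem_enum.
Qed.

Lemma mem_distr_gram (x : M) (w : 'cV[R]_n) : w \in distr X x ->
  exists z, Xmap X x ((Xmatrix x)^T *m z) = w.
Proof.
move=> /mem_distr[e ->]; have [z ze] := gram_image (Xmatrix x) e.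
by exists z; rewrite XmapE.
Qed.

Lemma XinvP (x : M) (w : 'cV[R]_n) : w \in distr X x ->
  perp_ker X x (Xinv X x w) /\ Xmap X x (Xinv X x w) = w.
Proof.
move=> /mem_distr_gram[z zw].
have ex : [set e | perp_ker X x e /\ Xmap X x e = w] ((Xmatrix x)^T *m z).
  by split=> //; exact: perp_ker_trmx.
exact: (xgetPex 0 (ex_intro _ _ ex)).
Qed.

Lemma Xinv_unique (x : M) (e : 'cV[R]_m) : perp_ker X x e ->
  Xinv X x (Xmap X x e) = e.
Proof.
move=> pe; have [pi iK] := XinvP (Xmap_distr x e).
exact: perp_ker_uniq pi pe iK.
Qed.

(** [e] and [Xinv X x (Xmap X x e)] have the same image, hence differ by an element of the kernel,
    to which [Xinv X x w] is orthogonal. *)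
Lemma dot_Xinv (x : M) (w : 'cV[R]_n) (e : 'cV[R]_m) : w \in distr X x ->
  dot (Xinv X x w) e = dot (Xinv X x (Xmap X x e)) (Xinv X x w).
Proof.
move=> wE; have [pw _] := XinvP wE; have [_ eK] := XinvP (Xmap_distr x e).
rewrite [RHS]dot_sym; apply/subr0_eq; rewrite -dotBr; apply: pw.
by move: eK; rewrite !XmapE mulmxBr => ->; rewrite subrr.
Qed.

(** X(x) is an isometry from the orthogonal complement of its kernel onto E_x, so its adjoint is its
    inverse there. *)
Lemma Yadj_Xinv (x : M) (w : 'cV[R]_n) : w \in distr X x ->
  Yadj X x w = Xinv X x w.
Proof.
move=> wE; apply: xget_unique => [e|y yP]; first exact: dot_Xinv.
by apply/subr0_eq/dot_eq0; rewrite dotBl yP dot_Xinv// subrr.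
Qed.

End PseudoInverse.

Lemma linear_continuous_coords {R : realType} (E F : normedModType R) (l : {linear E -> F}) :
  has_coords E -> continuous l.
Proof.
move=> [I [e [c [cc ce]]]] x.
rewrite (_ : l = (fun h => \sum_k c k h *: l (e k)) :> (E -> F)); last first.
  apply/funext => h; rewrite [in LHS](ce h) linear_sum.
  by apply: eq_bigr => k _; rewrite linearZ.
apply: differentiable_continuous; apply: differentiable_fsum => k.
by apply: differentiableZl; exact: linear_differentiable.
Qed.

(** * Symbols and horizontal lifts on GL(M) *)

Section InducedConnection.
Context {R : realType} (n m : nat) (M : charted 'cV[R]_n).
Hypothesis smM : smooth_manifold M.
Local Notation E := 'cV[R]_n.
Local Notation atM := (manifold_atlas smM).
Local Notation domP := (atlas_dom atM).

Lemma tangent_GLproj (u : GL M) (s : E * 'M[R]_n) :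
  tangent_map (@GLproj R n M) u s = s.1.
Proof.
have <- : 'D_s (@fst E 'M[R]_n) (@fwd _ _ (GL M) (at_ u) u) = s.1.
  by have [_ ->] := is_derive_fst (@fwd _ _ (GL M) (at_ u) u) s.
have iu := domP (GLproj u).
apply: near_eq_derive; apply: filterS (near_GL_chart smM iu iu) => -[y b] [_ _ yK _].
exact: yK.
Qed.

Variables (X : 'I_m -> vfield M) (A : vfield M).
Hypothesis smX : forall j, smooth_vf (X j).

Lemma smooth_vf_differentiable (W : vfield M) : smooth_vf W -> differentiable_vf W.
Proof.
move=> sW x; apply: (smooth_differentiable_at (has_coords_mx n 1)); last exact: sW.
exact: has_coords_mx.
Qed.

Lemma hliftE (Xt : 'I_m -> vfield (GL M)) (At : vfield (GL M)) (u : GL M) (w : E) :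
  (forall j, natural_lift (X j) (Xt j)) -> w \in distr X (GLproj u) ->
  hlift (diffusion_generator X A) (diffusion_generator Xt At) u w =
    \sum_(j < m) Xinv X (GLproj u) w j 0 *: Xt j u.
Proof.
move=> lX wE; set x := GLproj u.
have lin_of (alpha : E -> R) : scalar alpha ->
    exists l : {linear E -> R}, l = alpha :> (E -> R).
  move=> sa; have la : linear alpha by [].
  pose l : {linear E -> R} := HB.pack alpha (GRing.isLinear.Build _ _ _ _ _ la).
  by exists l.
have symM (l : {linear E -> R}) : symbol (diffusion_generator X A) x l =
    \sum_(j < m) (2^-1 * l (X j x)) *: X j x.
  apply: (symbol_diffusion_generator atM); first exact: has_coords_mx.
    by move=> j; exact: smooth_vf_differentiable.
  exact: linear_continuous_coords (has_coords_mx n 1).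
(* The projection has tangent map [fst], so the pulled-back covector sees only the base component
   [X j x] of each lift. *)
have symGL (l : {linear E -> R}) :
    symbol (diffusion_generator Xt At) u (fun s => l (tangent_map (@GLproj R n M) u s)) =
    \sum_(j < m) (2^-1 * l (X j x)) *: Xt j u.
  have llin : linear (l \o @fst E 'M[R]_n) by move=> a p q; rewrite /= linearP.
  pose ll : {linear (E * 'M[R]_n)%type -> R} :=
    HB.pack (l \o @fst E 'M[R]_n) (GRing.isLinear.Build _ _ _ _ _ llin).
  have coordsEM : has_coords (E * 'M[R]_n)%type.
    by apply: has_coords_prod; exact: has_coords_mx.
  rewrite (_ : (fun s => _) = ll); last by apply/funext => s; rewrite tangent_GLproj.
  rewrite (symbol_diffusion_generator (GL_atlas smM))//.
  - by apply: eq_bigr => j _; rewrite [ll _]/= (natural_liftE _ smM (lX j)).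
  - by move=> j; exact: (natural_lift_differentiable _ smM (lX j)).
  - exact: linear_continuous_coords.
have Xinv_sym (l : {linear E -> R}) : symbol (diffusion_generator X A) x l = w ->
    forall j, 2^-1 * l (X j x) = Xinv X x w j 0.
  rewrite symM => lw j; pose e : 'cV[R]_m := \col_j (2^-1 * l (X j x)).
  have eE : Xmap X x e = w by rewrite -lw; apply: eq_bigr => k _; rewrite mxE.
  rewrite -eE Xinv_unique ?mxE// => k Xk0.
  rewrite /dot; under eq_bigr do rewrite mxE -mulrA [l _ * _]mulrC.
  have lk : l (Xmap X x k) = \sum_(i < m) k i ord0 * l (X i x).
    by rewrite linear_sum; apply: eq_bigr => i _; rewrite linearZ.
  by rewrite -mulr_sumr -lk Xk0 linear0 mulr0.
apply: xget_unique => [alpha /lin_of[l <-] lw|z zP].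
  by rewrite symGL; apply: eq_bigr => j _; rewrite Xinv_sym.
(* [hlift] quantifies over all covectors with symbol [w], so uniqueness needs one of them. As X X^T
   z0 = w, the covector [2 z0^T] works, the 2 undoing the factor 1/2 of the symbol. *)
have [z0 z0w] := mem_distr_gram wE.
have linz : linear (fun v : E => 2 * (z0^T *m v) 0 0 : R).
  by move=> a v v'; rewrite mulmxDr -scalemxAr !mxE mulrDr mulrCA.
pose l : {linear E -> R} := HB.pack (fun v : E => 2 * (z0^T *m v) 0 0 : R)
  (GRing.isLinear.Build _ _ _ _ _ linz).
have lw : symbol (diffusion_generator X A) x l = w.
  rewrite symM -z0w; apply: eq_bigr => j _; congr (_ *: _).
  rewrite /= mulrA mulVf ?pnatr_eq0// mul1r !mxE; apply: eq_bigr => k _.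
  by rewrite !mxE mulrC.
rewrite (zP l (linearP l) lw) symGL; apply: eq_bigr => j _.
by rewrite Xinv_sym.
Qed.

End InducedConnection.

(** * Frame coordinates and the bracket with Z^w *)

Section Bracket.
Context {R : realType} (n m : nat) (M : charted 'cV[R]_n).
Hypothesis smM : smooth_manifold M.
Local Notation E := 'cV[R]_n.
Local Notation atM := (manifold_atlas smM).
Local Notation domP := (atlas_dom atM).
Local Notation bwdK := (atlas_fwdK atM).

(** The matrix [comp_cols L 1%:M] from the chart [i] to the preferred chart acts on both the frame
    and the vector, and cancels in u^-1 V. *)
Lemma frame_coord_in_chart (V : vfield M) (i : idx M) (y : E) (b : 'M[R]_n) :
  dom i (bwd i y) -> fwd i (bwd i y) = y -> b \in unitmx ->
  frame_coord V (@bwd _ _ (GL M) i (y, b)) = invmx b *m lieD V (fwd i) (bwd i y).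
Proof.
move=> iy yK bu; have Nu := GL_bwd_unit smM iy yK bu.
set L := fun v => 'D_v (fwd (at_ (bwd i y)) \o bwd i) y.
have linL : linear L.
  apply: linear_derive_at; have := transition_differentiable atM iy (domP _).
  by rewrite yK.
have VE : V (bwd i y) = comp_cols L 1%:M *m lieD V (fwd i) (bwd i y).
  rewrite comp_cols_mul//; have := bwd_dfun_fwd smM (V (bwd i y)) iy.
  by rewrite yK.
rewrite /frame_coord /frame_mx /= insubdK// -/L VE.
rewrite -[lieD V (fwd i) (bwd i y) in LHS](mulKVmx bu).
rewrite (mulmxA (comp_cols L 1%:M)).
by rewrite -comp_colsE// mulKmx.
Qed.

Lemma GL_fwd_at (u : GL M) :
  @fwd _ _ (GL M) (at_ u) u = (fwd (at_ (GLproj u)) (GLproj u), frame_mx u).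
Proof.
rewrite -[LHS]/(_, _); congr (_, _); apply: comp_cols_id => v.
exact: (dfun_fwd_at atM).
Qed.

(* Differentiate [b *m frame_coord V = V] in the chart rather than [invmx b]. *)
Lemma dfun_frame_coord (V : vfield M) (u : GL M) (h : E * 'M[R]_n) :
  differentiable_vf V ->
  frame_mx u *m dfun (frame_coord V) u h =
    dfun (lieD V (fwd (at_ (GLproj u)))) (GLproj u) h.1 -
    h.2 *m (invmx (frame_mx u) *m V (GLproj u)).
Proof.
move=> dV; set x := GLproj u; set i := at_ x; have ix : dom i x by exact: domP.
pose Vi := lieD V (fwd i) \o bwd i.
have dVi : differentiable Vi (fwd i x) by exact: dV.
pose p0 := (fwd i x, frame_mx u).
pose g (p : (E * 'M[R]_n)%type) := invmx p.2 *m Vi p.1.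
have dV1 : differentiable (Vi \o @fst E 'M[R]_n) p0.
  by apply: differentiable_comp; [exact: differentiable_fst|exact: dVi].
have dg : differentiable g p0.
  apply: differentiable_mulmx => //.
  by apply: differentiable_invmx; [exact: differentiable_snd|exact: frame_mx_unit].
have nGL := near_GL_chart smM ix ix; rewrite GL_fwd_at -/x -/i -/p0 in nGL.
have -> : dfun (frame_coord V) u h = 'D_h g p0.
  rewrite /dfun GL_fwd_at; apply: near_eq_derive.
  by apply: filterS nGL => -[y b] [iy _ yK bu]; exact: frame_coord_in_chart.
have Dsnd := is_derive_snd p0 h.
have Dg : is_derive p0 h g ('D_h g p0) by exact/derivableP/diff_derivable.
have [_] := is_derive_mulmx Dsnd Dg.
have -> : 'D_h (fun p => p.2 *m g p) p0 = dfun (lieD V (fwd i)) x h.1.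
  transitivity ('D_h (Vi \o @fst E 'M[R]_n) p0).
    apply: near_eq_derive; apply: filterS nGL => p [_ _ _ pu].
    by rewrite /g mulKVmx.
  rewrite (derive_comp _ (differentiable_fst p0) dVi).
  rewrite -[RHS]/('D_(h.1) Vi (fwd i x)) deriveE//; congr ('d _ _ _).
  by have [_ ->] := is_diff_fst p0.
have -> : V x = Vi (fwd i x).
  by rewrite /Vi /= bwdK// /lieD (dfun_fwd_at atM).
by move=> ->; rewrite addrK.
Qed.

Lemma lieD_comb (F : normedModType R) (X : 'I_m -> vfield M) (f : 'I_m -> M -> R)
    (g : M -> F) (x : M) : differentiable_at x g ->
  lieD (fun y => \sum_j f j y *: X j y) g x = \sum_j f j x *: lieD (X j) g x.
Proof.
move=> dg; pose l : {linear E -> F} :=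
  HB.pack (dfun g x) (GRing.isLinear.Build _ _ _ _ _ (dfun_linear dg)).
rewrite -[LHS]/(l _) linear_sum; apply: eq_bigr => j _.
by rewrite linearZ.
Qed.

Lemma differentiable_at_fwd (i : idx M) (x : M) : dom i x -> differentiable_at x (fwd i).
Proof. by move=> ix; apply: (transition_differentiable atM) => //; exact: domP. Qed.

Lemma near_lieD_comb (X : 'I_m -> vfield M) (f : 'I_m -> M -> R) (x : M) :
  \forall y \near fwd (at_ x) x,
    \sum_j f j (bwd (at_ x) y) *: lieD (X j) (fwd (at_ x)) (bwd (at_ x) y) =
    lieD (fun y => \sum_j f j y *: X j y) (fwd (at_ x)) (bwd (at_ x) y).
Proof.
have ix := domP x; apply: filterS (near_chart atM ix ix) => y [iy _ _].
by rewrite lieD_comb//; exact: differentiable_at_fwd.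
Qed.

Lemma dfun_lieD_comb (X : 'I_m -> vfield M) (f : 'I_m -> M -> R) (x : M) (v : E) :
  (forall j, differentiable_vf (X j)) -> (forall j, differentiable_at x (f j)) ->
  differentiable_at x (lieD (fun y => \sum_j f j y *: X j y) (fwd (at_ x))) /\
  dfun (lieD (fun y => \sum_j f j y *: X j y) (fwd (at_ x))) x v =
    \sum_j (f j x *: dfun (lieD (X j) (fwd (at_ x))) x v + dfun (f j) x v *: X j x).
Proof.
move=> dX df; split.
  apply: near_differentiable (near_lieD_comb X f x) _.
  apply: differentiable_fsum => j; apply: differentiable_scale.
  - exact: has_coords_mx.
  - exact: df.
  - exact: dX.
transitivity ('D_v (fun y => \sum_j f j (bwd (at_ x) y) *:
    lieD (X j) (fwd (at_ x)) (bwd (at_ x) y)) (fwd (at_ x) x)).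
  by apply: near_eq_derive; apply: filterS (near_lieD_comb X f x) => y ->.
have [_ ->] : is_derive (fwd (at_ x) x) v (fun y => \sum_j f j (bwd (at_ x) y) *:
    lieD (X j) (fwd (at_ x)) (bwd (at_ x) y))
  (\sum_j (f j x *: dfun (lieD (X j) (fwd (at_ x))) x v + dfun (f j) x v *: X j x)).
  apply: is_derive_fsum => j.
  have dXj : is_derive (fwd (at_ x) x) v (lieD (X j) (fwd (at_ x)) \o bwd (at_ x))
      (dfun (lieD (X j) (fwd (at_ x))) x v).
    by apply/derivableP/diff_derivable; exact: dX.
  have := is_derive_scale (is_derive_dfun v (df j)) dXj.
  rewrite /= bwdK; last exact: domP.
  by rewrite [lieD (X j) _ x](dfun_fwd_at atM).
by [].
Qed.

Variables (X : 'I_m -> vfield M) (A : vfield M).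
Hypothesis smX : forall j, smooth_vf (X j).

(** The coefficients of Z^w are frozen at [x], so only the fields [X j] get differentiated. *)
Lemma lie_bracket_Zsec (V : vfield M) (x : M) (w : E) : w \in distr X x ->
  lie_bracket (Zsec X x w) V x = dfun (lieD V (fwd (at_ x))) x w -
    \sum_j Xinv X x w j 0 *: dfun (lieD (X j) (fwd (at_ x))) x (V x).
Proof.
move=> wE; have [_ wK] := XinvP wE.
have ZE : Zsec X x w = fun y => \sum_j Xinv X x w j 0 *: X j y.
  by apply/funext => y; rewrite /Zsec Yadj_Xinv.
have Zx : Zsec X x w x = w by rewrite /Zsec Yadj_Xinv.
have E1 : lieD (Zsec X x w) (lieD V (fwd (at_ x))) x =
  dfun (lieD V (fwd (at_ x))) x w := congr1 (dfun _ x) Zx.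
have E2 : lieD V (lieD (Zsec X x w) (fwd (at_ x))) x =
    \sum_j Xinv X x w j 0 *: dfun (lieD (X j) (fwd (at_ x))) x (V x).
  have dX j : differentiable_vf (X j) := smooth_vf_differentiable (smX j).
  have dc (j : 'I_m) : differentiable_at x (fun _ : M => Xinv X x w j 0 : R).
    exact: differentiable_cst.
  have [_ dE] := dfun_lieD_comb (V x) dX dc.
  rewrite ZE; apply: etrans dE _; apply: eq_bigr => j _.
  have -> : dfun (fun _ : M => Xinv X x w j 0 : R) x (V x) = 0.
    exact: (derive_cst (Xinv X x w j 0 : R)).
  by rewrite scale0r addr0.
by rewrite /lie_bracket E1 E2.
Qed.

Lemma induced_connection_bracket (Xt : 'I_m -> vfield (GL M)) (At : vfield (GL M))
    (V : vfield M) (x : M) (w : E) :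
  (forall j, natural_lift (X j) (Xt j)) -> differentiable_vf V ->
  w \in distr X x ->
  induced_connection (diffusion_generator X A) (diffusion_generator Xt At) x w V =
    lie_bracket (Zsec X x w) V x.
Proof.
move=> lX dV wE.
have key (u : GL M) : GLproj u = x -> frame_mx u *m dfun (frame_coord V) u
    (hlift (diffusion_generator X A) (diffusion_generator Xt At) u w) =
    lie_bracket (Zsec X x w) V x.
  move=> ux; have wE' : w \in distr X (GLproj u) by rewrite ux.
  rewrite (hliftE smM A smX At lX wE') ux.
  set h := \sum_(j < m) _.
  have h1 : h.1 = w.
    rewrite /h (big_morph fst (fun _ _ => erefl) erefl)/=.
    have [_ {2}<-] := XinvP wE; apply: eq_bigr => j _.
    by rewrite (natural_liftE _ smM (lX j)) ux.
  (* The frame component of each lift is DX^j composed with [u], and this [u] cancels against u^-1: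
     hence the independence of the frame. *)
  have h2 : h.2 *m (invmx (frame_mx u) *m V x) =
      \sum_j Xinv X x w j 0 *: dfun (lieD (X j) (fwd (at_ x))) x (V x).
    rewrite /h (big_morph snd (fun _ _ => erefl) erefl)/= mulmx_suml.
    apply: eq_bigr => j _; rewrite (natural_liftE _ smM (lX j)) ux.
    rewrite -scalemxAl [(_, _).2]/=.
    have linD : linear (fun v =>
        'D_v (lieD (X j) (fwd (at_ x)) \o bwd (at_ x)) (fwd (at_ x) x)).
      by apply: linear_derive_at; exact: (smooth_vf_differentiable (smX j)).
    by rewrite comp_colsE// -mulmxA mulKVmx ?frame_mx_unit// comp_cols_mul.
  rewrite (dfun_frame_coord u h dV) ux h1 h2.
  by rewrite lie_bracket_Zsec.
apply: xget_unique => [u ux|z zP]; first by rewrite key.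
(* Uniqueness needs one frame above [x]; the identity matrix in the preferred chart is one. *)
pose u : GL M := mk_frame x 1%:M.
by rewrite (zP u erefl) key.
Qed.

End Bracket.

(** * The LeJan-Watanabe connection *)

Section ConstantRank.
Context {R : realType}.

(** The [r] columns of [P Q] span the column space of [P], so [P = P Q C] for some [C], and
    multiplying by [L] determines [C] from [L P]. Thus [P] can be recovered from [L P]. *)
Lemma mxrank_factor n m r (P : 'M[R]_(n, m)) (L : 'M[R]_(r, n)) (Q : 'M[R]_(m, r)) :
  \rank P = r -> L *m P *m Q \in unitmx ->
  P *m Q *m (invmx (L *m P *m Q) *m (L *m P)) = P.
Proof.
move=> rP LPQ; have rPQ : \rank (P *m Q) = r.
  apply/eqP; rewrite eqn_leq rank_leq_col/=.
  by have := mxrankM_maxr L (P *m Q); rewrite mulmxA mxrank_unit.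
have /submxP[D PD] : (P^T <= (P *m Q)^T)%MS.
  rewrite trmx_mul; have [_ <-] := mxrank_leqif_sup (submxMl Q^T P^T).
  by rewrite -trmx_mul !mxrank_tr rP rPQ.
have PE : P = P *m Q *m D^T by apply: trmx_inj; rewrite trmx_mul trmxK.
have LPE : L *m P = L *m P *m Q *m D^T by rewrite {1}PE !mulmxA.
by rewrite [X in _ *m (_ *m X)]LPE mulKmx// -PE.
Qed.

Lemma mxrank_inverses n m (P : 'M[R]_(n, m)) :
  exists (L : 'M[R]_(\rank P, n)) (Q : 'M[R]_(m, \rank P)), L *m P *m Q = 1%:M.
Proof.
have /row_fullP[L LC] := col_base_full P; have /row_freeP[Q DQ] := row_base_free P.
exists L, Q; have : L *m (col_base P *m row_base P) *m Q = 1%:M.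
  by rewrite mulmxA LC mul1mx DQ.
by rewrite mulmx_base.
Qed.

Lemma gram_unit r m (K : 'M[R]_(r, m)) (Q : 'M[R]_(m, r)) :
  K *m Q \in unitmx -> K *m K^T \in unitmx.
Proof.
move=> KQ; rewrite -row_free_unit /row_free mxrank_gram eqn_leq rank_leq_row/=.
by have := mxrankM_maxl K Q; rewrite mxrank_unit.
Qed.

Context (n m : nat) (M : charted 'cV[R]_n).
Local Notation E := 'cV[R]_n.
Variable X : 'I_m -> vfield M.

(** Rank and dimension meet in the column base of the matrix: its columns are free because it has a
    left inverse, and they span the same space as the fields. *)
Lemma dim_distr (x : M) : \dim (distr X x) = \rank (Xmatrix X x).
Proof.
set P := Xmatrix X x.
have /row_fullP[L LC] := col_base_full P; have /row_freeP[Q DQ] := row_base_free P.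
pose C := col_base P; pose cols := [tuple col k C | k < \rank P].
have colsE (k : 'I_(\rank P)) : cols`_k = col k C.
  by rewrite (nth_map k) ?size_enum_ord// nth_ord_enum.
have sum_cols (z : 'cV[R]_(\rank P)) : C *m z = \sum_k z k 0 *: col k C.
  apply/colP => i; rewrite summxE mxE; apply: eq_bigr => k _.
  by rewrite !mxE mulrC.
have -> : distr X x = <<cols>>%VS.
  apply/eqP; rewrite eqEsubv; apply/andP; split.
    apply/span_subvP => _ /mapP[j _ ->].
    have -> : X j x = C *m col j (row_base P).
      rewrite colE mulmxA mulmx_base -colE.
      by apply/colP => i; rewrite !mxE.
    rewrite sum_cols; apply: rpred_sum => k _; apply: rpredZ.
    by rewrite -colsE; apply: memv_span; apply: mem_nth; rewrite size_tuple.
  apply/span_subvP => _ /mapP[k _ ->].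
  (* [Q] is a right inverse of the row base, so [P Q = C] and each column of [C] is a value of
     [Xmap]. *)
  have -> : col k C = Xmap X x (Q *m delta_mx k 0).
    have : C *m row_base P *m Q = C by rewrite -mulmxA DQ mulmx1.
    by rewrite mulmx_base XmapE -/P mulmxA => ->; rewrite colE.
  exact: Xmap_distr.
have /eqP-> : free cols.
  apply/freeP => k; under eq_bigr do rewrite colsE.
  pose z : 'cV[R]_(\rank P) := \col_i k i.
  move=> k0; have : C *m z = 0.
    by rewrite sum_cols -[RHS]k0; apply: eq_bigr => i _; rewrite mxE.
  move=> /(congr1 (mulmx L)); rewrite mulmxA LC mul1mx mulmx0 => z0 i.
  by have := congr1 (fun u : 'cV_(\rank P) => u i 0) z0; rewrite !mxE.
by rewrite size_tuple.
Qed.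

Hypothesis smM : smooth_manifold M.
Hypothesis smX : forall j, smooth_vf (X j).
Local Notation atM := (manifold_atlas smM).
Local Notation domP := (atlas_dom atM).
Local Notation bwdK := (atlas_fwdK atM).

(* With [K y := L *m P y], where [P y] is [X] in the chart, the minimal-norm
   solution of [P y *m f = u] is [K^T (K K^T)^-1 L u], because [P y] and [K y]
   have the same kernel as long as [P y] keeps its rank. *)
Lemma differentiable_Xinv (U : vfield M) (p : nat) (x : M) (j : 'I_m) :
  (forall x, \dim (distr X x) = p) -> differentiable_vf U ->
  (forall x, U x \in distr X x) ->
  differentiable_at x (fun y => Xinv X y (U y) j 0 : R).
Proof.
move=> dimX dU UE; set i := at_ x; have ix : dom i x by exact: domP.
pose P (y : E) : 'M[R]_(n, m) := \matrix_(k, j) lieD (X j) (fwd i) (bwd i y) k 0.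
pose ul := lieD U (fwd i) \o bwd i.
have dul : differentiable ul (fwd i x) by exact: dU.
have dP : differentiable P (fwd i x).
  apply: differentiable_mx => k l; under eq_fun do rewrite mxE.
  apply: (@differentiable_entry _ _ _ _ (lieD (X l) (fwd i) \o bwd i)).
  exact: smooth_vf_differentiable.
(* [T y] passes from the preferred chart of the point to the fixed chart [i]: it turns the possibly
   discontinuous [Xmatrix] into [P], differentiable at the base point, without changing the rank. *)
pose T (y : E) := comp_cols (dfun (fwd i) (bwd i y)) 1%:M.
have fwd_lin y : dom i (bwd i y) -> linear (dfun (fwd i) (bwd i y)).
  by move=> iy; apply: dfun_linear; exact: (differentiable_at_fwd smM).
have TE y v : dom i (bwd i y) -> dfun (fwd i) (bwd i y) v = T y *m v.
  by move=> /fwd_lin linT; rewrite comp_cols_mul.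
have PE y : dom i (bwd i y) -> P y = T y *m Xmatrix X (bwd i y).
  move=> iy; apply/matrixP => k l; rewrite mxE [lieD _ _ _](TE y _ iy) !mxE.
  by apply: eq_bigr => q _; rewrite [Xmatrix _ _ _ _]mxE.
have Tunit y : dom i (bwd i y) -> T y \in unitmx by exact: (dfun_fwd_unit smM).
have rP y : dom i (bwd i y) -> \rank (P y) = p.
  move=> iy; rewrite PE// -(dimX (bwd i y)) dim_distr.
  by rewrite (eqmxMfull _ _)// row_full_unit Tunit.
(* [L] and [Q] are chosen at the base point and then kept: [K y *m Q] is the identity there and
   stays invertible nearby, and constant rank lets [mxrank_factor] apply. *)
have [L [Q LPQ]] := mxrank_inverses (P (fwd i x)).
pose K y := L *m P y.
have dK : differentiable K (fwd i x).
  by apply: differentiable_mulmx => //; exact: differentiable_cst.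
have dKQ : differentiable (fun y => K y *m Q) (fwd i x).
  by apply: differentiable_mulmx => //; exact: differentiable_cst.
have KQ0 : K (fwd i x) *m Q \in unitmx by rewrite LPQ unitmx1.
have nKQ := near_unitmx dKQ KQ0.
pose F y := (K y)^T *m (invmx (K y *m (K y)^T) *m (L *m ul y)).
have dF : differentiable F (fwd i x).
  have dKT := differentiable_trmx dK.
  apply: differentiable_mulmx => //; apply: differentiable_mulmx.
    apply: differentiable_invmx; first exact: differentiable_mulmx.
    exact: gram_unit KQ0.
  by apply: differentiable_mulmx => //; exact: differentiable_cst.
apply: (@near_differentiable _ _ _ (fun y => F y j 0)); last first.
  exact: differentiable_entry.
apply: filterS2 nKQ (near_chart atM ix ix) => y KQ [iy _ _].
rewrite /=; set z := bwd i y; congr (_ _ _).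
have [e eE] := mem_distr (UE z).
have ulE : ul y = P y *m e.
  by rewrite /ul /= [lieD _ _ _](TE y _ iy) -/z eE PE// mulmxA.
have rPy : \rank (P y) = \rank (P (fwd i x)).
  by rewrite rP// rP// bwdK.
have KF : K y *m F y = K y *m e.
  by rewrite /F ulE (mulmxA L) -/(K y) mulmxA mulKVmx//; exact: gram_unit KQ.
have PF : P y *m F y = ul y.
  have fac : P y *m Q *m (invmx (K y *m Q) *m K y) = P y.
    exact: mxrank_factor rPy KQ.
  rewrite ulE; move: (K y) (F y) KF fac => Ky Fy KF fac.
  by rewrite -fac -!mulmxA KF.
have XF : Xmap X z (F y) = U z.
  apply: (can_inj (mulKmx (Tunit y iy))).
  by rewrite XmapE mulmxA -PE// PF /ul /= [lieD _ _ _](TE y _ iy).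
have pF : perp_ker X z (F y).
  move=> k; rewrite XmapE => Xk0.
  have Pk0 : P y *m k = 0 by rewrite (PE y iy) -mulmxA Xk0 mulmx0.
  have Kk0 : K y *m k = 0 by rewrite /K -mulmxA Pk0 mulmx0.
  by rewrite dotE /F trmx_mul trmxK -mulmxA Kk0 mulmx0 mxE.
by rewrite -XF Xinv_unique.
Qed.

End ConstantRank.

(** * Explicit formula for the connection *)

Section LeJanWatanabeFormula.
Context {R : realType} (n m : nat) (M : charted 'cV[R]_n).
Hypothesis smM : smooth_manifold M.
Local Notation E := 'cV[R]_n.
Variables (X : 'I_m -> vfield M) (nabla : connection_type M).
Hypothesis conn : connection_on_E X nabla.

Lemma connection_comb (k : nat) (Y : 'I_k -> vfield M) (f : 'I_k -> M -> R)
    (x : M) (v : E) :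
  (forall j, dsection X (Y j)) -> (forall j y, differentiable_at y (f j)) ->
  dsection X (fun y => \sum_j f j y *: Y j y) /\
  nabla x v (fun y => \sum_j f j y *: Y j y) =
    \sum_j (dfun (f j) x v *: Y j x + f j x *: nabla x v (Y j)).
Proof.
have sec q (Y' : 'I_q -> vfield M) (f' : 'I_q -> M -> R) :
    (forall j, dsection X (Y' j)) -> (forall j y, differentiable_at y (f' j)) ->
    dsection X (fun y => \sum_j f' j y *: Y' j y).
  move=> dY df; split=> y.
    by have [] := dfun_lieD_comb smM 0 (fun j => (dY j).1) (fun j => df j y).
  by apply: rpred_sum => j _; apply: rpredZ; exact: (dY j).2.
move=> dY df; split; first exact: sec.
elim: k Y f dY df => [|k IHk] Y f dY df.
  (* The zero section has derivative 0 by the Leibniz rule with coefficient 0. *)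
  under eq_fun do rewrite big_ord0; rewrite big_ord0.
  have d0 : dsection X (fun=> 0).
    have := sec 0 Y f dY df; by under eq_fun do rewrite big_ord0.
  have dc y : differentiable_at y (fun _ : M => 0 : R) by exact: differentiable_cst.
  have := conn_leibniz conn x v dc d0.
  under eq_fun do rewrite scale0r; move=> ->.
  by rewrite scaler0 add0r scale0r.
under eq_fun do rewrite big_ord_recr/=; rewrite big_ord_recr/=.
have dYk j : dsection X (Y (widen_ord (leqnSn k) j)) by [].
have dfk j y : differentiable_at y (f (widen_ord (leqnSn k) j)) by [].
have d1 : dsection X (fun y => f ord_max y *: Y ord_max y).
  have := sec 1 (fun=> Y ord_max) (fun=> f ord_max) (fun=> dY _) (fun=> df _).
  by under eq_fun do rewrite big_ord1.
rewrite (conn_add conn x v (sec _ _ _ dYk dfk) d1); congr (_ + _); first exact: IHk.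
exact: (conn_leibniz conn x v (df ord_max) (dY ord_max)).
Qed.

Hypothesis smX : forall j, smooth_vf (X j).
Hypothesis perp_parallel : forall x v e, perp_ker X x e ->
  nabla x v (fun y => Xmap X y e) = 0.

Lemma X_dsection (j : 'I_m) : dsection X (X j).
Proof.
split; first exact: smooth_vf_differentiable (smX j).
move=> x; apply: memv_span; apply/mapP; exists j => //.
by rewrite mem_enum.
Qed.

(** The right-hand side is X(x) d(Y U)(v), the closed formula for the connection, as [Yadj] and
    [Xinv] agree on E. *)
Lemma LeJanWatanabeE (U : vfield M) (p : nat) (x : M) (v : E) :
  (forall x, \dim (distr X x) = p) -> dsection X U ->
  nabla x v U =
    \sum_j dfun (fun y => Xinv X y (U y) j 0 : R) x v *: X j x.
Proof.
move=> dimX [dU UE].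
have df (j : 'I_m) y : differentiable_at y (fun y => Xinv X y (U y) j 0 : R).
  exact: (differentiable_Xinv smM smX y j dimX dU UE).
have [_ combU] := connection_comb x v X_dsection df.
have UX : U = fun y => \sum_j Xinv X y (U y) j 0 *: X j y.
  by apply/funext => y; have [_ {1}<-] := XinvP (UE y).
(* With coefficients frozen at [x] the combination becomes X(.)e with [e] orthogonal to the kernel;
   expanding its zero derivative shows that the undifferentiated terms sum to 0. *)
have dc (j : 'I_m) y : differentiable_at y (fun _ : M => Xinv X x (U x) j 0 : R).
  exact: differentiable_cst.
have [_ combZ] := connection_comb x v X_dsection dc.
have [perpU _] := XinvP (UE x).
have Z0 : \sum_j Xinv X x (U x) j 0 *: nabla x v (X j) = 0.
  rewrite -[RHS](perp_parallel v perpU); apply: esym; apply: etrans combZ _.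
  apply: eq_bigr => j _.
  have -> : dfun (fun _ : M => Xinv X x (U x) j 0 : R) x v = 0.
    exact: (derive_cst (Xinv X x (U x) j 0 : R)).
  by rewrite scale0r add0r.
by rewrite {1}UX combU big_split/= Z0 addr0.
Qed.

End LeJanWatanabeFormula.

Theorem theorem3p1 (R : realType) (n m : nat) (M : charted 'cV[R]_n)
    (X : 'I_m -> vfield M) (A : vfield M)
    (B : (GL M -> R) -> (GL M -> R))
    (nablaLW : connection_type M) :
  smooth_manifold M ->
  (forall j, smooth_vf (X j)) -> smooth_vf A ->
  (exists p : nat, forall x, \dim (distr X x) = p) ->
  derivative_process_generator X A B ->
  LeJanWatanabe X nablaLW ->
  let nabla := induced_connection (diffusion_generator X A) B in
  adjoint_connection X nablaLW nabla /\
  (forall V x w, differentiable_vf V -> w \in distr X x ->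
     nabla x w V = lie_bracket (Zsec X x w) V x /\
     nablaLW x (V x) (Zsec X x w) = 0).
Proof.
move=> smM smX smA [p dimX] [Xt [At [lX lA BE]]] [conn _ perp] nabla.
have nablaE V x w : differentiable_vf V -> w \in distr X x ->
    nabla x w V = lie_bracket (Zsec X x w) V x.
  by rewrite /nabla BE; exact: induced_connection_bracket.
split=> [x U V dU dV|V x w dV wE]; last first.
  split; first exact: nablaE.
  (* Z^w is X(.)e for the fixed vector e = Y_x w, which is orthogonal to ker X(x). *)
  by rewrite /Zsec Yadj_Xinv//; apply: perp; have [] := XinvP wE.
have [dUvf UE] := dU.
apply: etrans (nablaE V x (U x) dV (UE x)) _.
rewrite (lie_bracket_Zsec smM smX V (UE x)).
rewrite (LeJanWatanabeE smM conn smX perp x (V x) dimX dU).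
have UX : U = fun y => \sum_j Xinv X y (U y) j 0 *: X j y.
  by apply/funext => y; have [_ {1}<-] := XinvP (UE y).
have df (j : 'I_m) : differentiable_at x (fun y => Xinv X y (U y) j 0 : R).
  exact: (differentiable_Xinv smM smX x j dimX dUvf UE).
have [_ dUE] := dfun_lieD_comb smM (V x)
  (fun j => smooth_vf_differentiable (smX j)) df.
rewrite -UX big_split/= in dUE.
(* With w = U(x), [a] is D_w V, [b] is D_V Z^w and [c] is the connection term; the derivative of [U]
   along [V] is [b + c]. *)
have cancel_sum (a b c : 'cV[R]_n) : a - b = c + (a - (b + c)).
  by rewrite [RHS]addrC opprD [a + (- b - c)]addrA subrK.
have -> : lie_bracket U V x = _ :=
  congr1 (fun b => dfun (lieD V (fwd (at_ x))) x (U x) - b) dUE.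
exact: cancel_sum.
Qed.
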